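(* Let $N\stackrel{\varphi}{\to}\Gamma$ be a crossed module and $\mathcal A_\bullet$ a complex of abelian sheaves over the $\Delta_2$-space $(N\rtimes\Gamma)_{\bullet\bullet}$. 1. There is a chain map (the total transgression map) $$T=\sum_kT_k:C^*(\Gamma_\bullet;\mathcal A_\bullet)\to C^*((N\rtimes\Gamma)_{\bullet\bullet};\mathcal A_\bullet).$$ Moreover $T_k=\sum_{\sigma\in S_{k,l}}\varepsilon(\sigma)\tilde f_\sigma^*:C^{k+l}(\Gamma_\bullet;\mathcal A_\bullet)\to C^l((N_k\rtimes\Gamma)_\bullet;\mathcal A_\bullet)$, where $S_{k,l}$ denotes the set of $(k,l)$-shuffles and the map $\tilde f_\sigma:N_k\rtimes\Gamma_l\to\Gamma_{k+l}$ is given by $\tilde f_\sigma(x_1,\dots,x_k;g_1,\dots,g_l)=(u_1,\dots,u_{k+l})$, where $u_i=g_{\sigma^{-1}(i)-k}$ if $\sigma^{-1}(i)\ge k+1$, and $u_i=\varphi\Big(x_{\sigma^{-1}(i)}^{\prod_{\sigma^{-1}(j)>k,\,j<i}g_{\sigma^{-1}(j)-k}}\Big)$ otherwise (product in increasing order of $j$). 2. There is a transgression map $T_1:H^*(\Gamma_\bullet;\mathcal A_\bullet)\to H^{*-1}((N_1\rtimes\Gamma)_\bullet;\mathcal A_\bullet)$, which is given on the cochain level by $$T_1=\sum_{i=0}^{p-1}(-1)^i\tilde f_i^*:\mathcal A^q(\Gamma_p)\to\mathcal A^q(N_1\rtimes\Gamma_{p-1}),$$ where the map $\tilde f_i:N_1\rtimes\Gamma_{p-1}\to\Gamma_p$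 is given by $\tilde f_i(x;g_1,\dots,g_{p-1})=(g_1,\dots,g_i,\varphi(x)^{g_1\cdots g_i},g_{i+1},\dots,g_{p-1})$.
   Context: **Crossed modules.** In a groupoid $\Gamma\rightrightarrows\Gamma_0$, $gh$ is defined iff $s(g)=t(h)$; $\Gamma_n$ is the space of composable $n$-tuples. A crossed module $N\stackrel{\varphi}{\to}\Gamma$ is a groupoid morphism, identity on units $N_0=\Gamma_0$, where $N=N_1\rightrightarrows N_0$ is a bundle of groups, with a right action $(x,g)\mapsto x^g$ of $\Gamma$ on $N$ by automorphisms ($x^g$ defined iff $t(x)=t(g)$, then $t(x^g)=s(g)$; $x^gy^g=(xy)^g$) such that $\varphi(x^g)=\varphi(x)^g:=g^{-1}\varphi(x)g$ and $x^{\varphi(y)}=y^{-1}xy$. $N_k$ ($k\ge1$) is the space of $k$-tuples in a common fibre of $N$, with its $\Gamma$-action, and $(N\rtimes\Gamma)_{k,l}=N_k\rtimes\Gamma_l=\{(x_1,\dots,x_k;g_1,\dots,g_l):t(x_1)=\dots=t(x_k)=t(g_1),\ (g_1,\dots,g_l)\in\Gamma_l\}$, with $(N\rtimes\Gamma)_{0,\bullet}=\Gamma_\bullet$. **$\Delta_2$-structure and sheaves.** Write $[k]=\{0,\dots,k\}$; all maps between such sets are nondecreasing. The category $\Delta_2$ has objects $(k,l)\in\mathbb N^2$; a morphism $(k,l)\to(k',l')$ is a triple $(a,b,c)$ where $a$ is $\emptyset$ or a map $[k]\to[k']$, $b$ is $\emptyset$ or a map $[l]\to[k']$, $c:[l]\to[l']$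 is a map, and $a=\emptyset$ or $b=\emptyset$. Composition: $(a',\emptyset,c')\circ(a,\emptyset,c)=(a'\circ a,\emptyset,c'\circ c)$, $(a',\emptyset,c')\circ(\emptyset,b,c)=(\emptyset,a'\circ b,c'\circ c)$, $(\emptyset,b',c')\circ(a,b,c)=(\emptyset,b'\circ c,c'\circ c)$. A morphism $f:(k,l)\to(k',l')$ induces $\tilde f:N_{k'}\rtimes\Gamma_{l'}\to N_k\rtimes\Gamma_l$, $(x',g')\mapsto(x,g)$, making $(N\rtimes\Gamma)_{\bullet\bullet}$ a $\Delta_2$-space (contravariant functor from $\Delta_2$ to topological spaces): for $(a,\emptyset,c)$, $x_i=(x'_{a(i-1)+1}\cdots x'_{a(i)})^{g'_1\cdots g'_{c(0)}}$ and $g_i=g'_{c(i-1)+1}\cdots g'_{c(i)}$; for $(\emptyset,b,c)$, $x_i$ is the unit at the object $t(g'_{c(0)+1})=s(g'_{c(0)})$ and $g_i=\varphi(x'_{b(i-1)+1}\cdots x'_{b(i)})^{g'_1\cdots g'_{c(i-1)}}g'_{c(i-1)+1}\cdots g'_{c(i)}$ (empty products are units; $a=\emptyset$ or $b=\emptyset$ in $(\emptyset,\emptyset,c)$ is read as a constant map here). An abelian sheaf over the $\Delta_2$-space $(N\rtimes\Gamma)_{\bullet\bullet}$ is a family of abelian sheaves on the spaces $(N\rtimes\Gamma)_{k,l}$ with, for each morphism $f$ of $\Delta_2$, restriction maps $\tilde f^*:\mathcal A(U)\to\mathcal A(V)$ whenever $\tilde f(V)\subset U$, functorial in $f$ (e.g.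 the sheaf $\mathcal S^1$ of $S^1$-valued smooth functions, or $q$-forms $\Omega^q$). **Cochains.** $\mathcal A_\bullet=(\mathcal A_0\stackrel{d}{\to}\mathcal A_1\to\cdots)$; $\mathcal A^q=\mathcal A_q$. With $\varepsilon_i:[m]\to[m+1]$ the increasing map omitting $i$, $\partial=\sum_i(-1)^i\tilde f^*$ over $f=(\mathrm{Id},\emptyset,\varepsilon_i)$ (faces of the nerve of $N_k\rtimes\Gamma$) and $\partial'=\sum_i(-1)^i\tilde f^*$ over $f=(\varepsilon_i,\emptyset,\mathrm{Id})$ (faces of $N_\bullet$). $C^n((N_k\rtimes\Gamma)_\bullet;\mathcal A_\bullet)=\bigoplus_{p+q=n}\mathcal A_q(N_k\rtimes\Gamma_p)$ with differential $(-1)^pd+\partial$ (for $k=0$ this is $C^*(\Gamma_\bullet;\mathcal A_\bullet)$), and $C^n((N\rtimes\Gamma)_{\bullet\bullet};\mathcal A_\bullet)=\bigoplus_{k+p+q=n}\mathcal A_q(N_k\rtimes\Gamma_p)$ with differential $(-1)^{k+p}d+(-1)^k\partial+\partial'$. $H^*$ denotes the cohomology of these complexes. In the formula for $T_k$, the superscripts $k+l$ and $l$ refer to the simplicial degree: $T_k$ maps $\mathcal A_q(\Gamma_{k+l})$ to $\mathcal A_q(N_k\rtimes\Gamma_l)$; $T_0=\mathrm{Id}$. **Shuffles.** A $(k,l)$-shuffle is a permutation $\sigma$ of $\{1,\dots,k+l\}$ with $\sigma(1)<\dots<\sigma(k)$ and $\sigma(k+1)<\dots<\sigma(k+l)$;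 $\varepsilon(\sigma)$ is its signature. $\tilde f_\sigma$ and $\tilde f_\sigma^*$ are the map and the restriction map of the morphism $f_\sigma=(\emptyset,b^\sigma,c^\sigma):(0,k+l)\to(k,l)$ of $\Delta_2$, where $b^\sigma(i)=\#(\sigma(\{1,\dots,k\})\cap\{1,\dots,i\})$ and $c^\sigma(i)=\#(\sigma(\{k+1,\dots,k+l\})\cap\{1,\dots,i\})$; $\tilde f_i$ is $\tilde f_\sigma$ for the $(1,p-1)$-shuffle with $\sigma(1)=i+1$.
   Formalization: The restriction maps of a sheaf over the Δ_2-space are also required to agree for morphisms (a,b,c), with the same c, whose a and b are each empty or constant (they induce the same map of spaces); with functoriality alone T_0=Id fails and T_1 need not descend to cohomology. *)

(* Defs.v *)
From HB Require Import structures.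
From mathcomp Require Import all_boot all_order all_algebra all_fingroup.
From mathcomp Require Import generic_quotient ring_quotient.
From mathcomp Require Import all_classical topology.

Set Implicit Arguments.
Unset Strict Implicit.
Unset Printing Implicit Defensive.

Import Order.TTheory GRing.Theory.
Local Open Scope classical_set_scope.
Local Open Scope ring_scope.

(** ** Topological groupoids and crossed modules *)

(* The partial operations are total functions, constrained only where they are
   defined in the source: [gmul g h] is meaningful when [gsrc g = gtgt h]. *)
Record groupoid (G0 G1 : topologicalType) := Groupoid {
  gsrc : G1 -> G0;
  gtgt : G1 -> G0;
  gunit : G0 -> G1;
  gmul : G1 -> G1 -> G1;
  ginv : G1 -> G1;
  gsrc_continuous : continuous gsrc;
  gtgt_continuous : continuous gtgt;
  gunit_continuous : continuous gunit;
  ginv_continuous : continuous ginv;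
  gmul_continuous : {within [set p : G1 * G1 | gsrc p.1 = gtgt p.2],
                     continuous (fun p => gmul p.1 p.2)};
  gsrc_unit : forall v, gsrc (gunit v) = v;
  gtgt_unit : forall v, gtgt (gunit v) = v;
  gsrc_mul : forall g h, gsrc g = gtgt h -> gsrc (gmul g h) = gsrc h;
  gtgt_mul : forall g h, gsrc g = gtgt h -> gtgt (gmul g h) = gtgt g;
  gmulA : forall g h i, gsrc g = gtgt h -> gsrc h = gtgt i ->
    gmul g (gmul h i) = gmul (gmul g h) i;
  gmul1g : forall g, gmul (gunit (gtgt g)) g = g;
  gmulg1 : forall g, gmul g (gunit (gsrc g)) = g;
  gsrc_inv : forall g, gsrc (ginv g) = gtgt g;
  gtgt_inv : forall g, gtgt (ginv g) = gsrc g;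
  gmulgV : forall g, gmul g (ginv g) = gunit (gtgt g);
  gmulVg : forall g, gmul (ginv g) g = gunit (gsrc g)
}.

(* [gconj G h g] is h^g = g^-1 h g, for h an arrow from t(g) to itself. *)
Definition gconj (G0 G1 : topologicalType) (G : groupoid G0 G1) (h g : G1) :=
  gmul G (gmul G (ginv G g) h) g.

(* The product u_1 ... u_m of a composable list whose first target is [v]. *)
Definition gprod (G0 G1 : topologicalType) (G : groupoid G0 G1) (v : G0)
  (u : seq G1) : G1 := foldl (gmul G) (gunit G v) u.

Record crossed_module (G0 N1 G1 : topologicalType) := CrossedModule {
  cmN : groupoid G0 N1;
  cmG : groupoid G0 G1;
  cmN_bundle : forall x, gsrc cmN x = gtgt cmN x;
  phi : N1 -> G1;
  phi_continuous : continuous phi;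
  gsrc_phi : forall x, gsrc cmG (phi x) = gsrc cmN x;
  gtgt_phi : forall x, gtgt cmG (phi x) = gtgt cmN x;
  phi_unit : forall v, phi (gunit cmN v) = gunit cmG v;
  phi_mul : forall x y, gtgt cmN x = gtgt cmN y ->
    phi (gmul cmN x y) = gmul cmG (phi x) (phi y);
  (* x^g, meaningful when t(x) = t(g) *)
  cm_act : N1 -> G1 -> N1;
  cm_act_continuous : {within [set p : N1 * G1 | gtgt cmN p.1 = gtgt cmG p.2],
                    continuous (fun p => cm_act p.1 p.2)};
  gtgt_cm_act : forall x g, gtgt cmN x = gtgt cmG g ->
    gtgt cmN (cm_act x g) = gsrc cmG g;
  cm_act_mul : forall x y g, gtgt cmN x = gtgt cmG g -> gtgt cmN y = gtgt cmG g ->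
    cm_act (gmul cmN x y) g = gmul cmN (cm_act x g) (cm_act y g);
  cm_act1 : forall x, cm_act x (gunit cmG (gtgt cmN x)) = x;
  cm_actM : forall x g h, gtgt cmN x = gtgt cmG g -> gsrc cmG g = gtgt cmG h ->
    cm_act x (gmul cmG g h) = cm_act (cm_act x g) h;
  phi_cm_act : forall x g, gtgt cmN x = gtgt cmG g ->
    phi (cm_act x g) = gconj cmG (phi x) g;
  cm_act_phi : forall x y, gtgt cmN x = gtgt cmN y ->
    cm_act x (phi y) = gconj cmN x y
}.

(** ** The category Delta_2 *)

Record mono m n := Mono {
  mono_fun :> {ffun 'I_m.+1 -> 'I_n.+1};
  mono_nd : [forall i : 'I_m.+1, forall j : 'I_m.+1,
               (i <= j)%N ==> (mono_fun i <= mono_fun j)%N]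
}.
HB.instance Definition _ m n := [isSub for @mono_fun m n].
HB.instance Definition _ m n := [Equality of mono m n by <:].

Lemma mono_ofP m n (f : 'I_m.+1 -> 'I_n.+1) :
  (forall i j : 'I_m.+1, (i <= j)%N -> (f i <= f j)%N) ->
  [forall i : 'I_m.+1, forall j : 'I_m.+1, (i <= j)%N ==>
     ([ffun x => f x] i <= [ffun x => f x] j)%N].
Proof.
by move=> fnd; apply/forallP => i; apply/forallP => j; apply/implyP;
  rewrite !ffunE; apply: fnd.
Qed.

Definition mono_of m n (f : 'I_m.+1 -> 'I_n.+1) fnd : mono m n :=
  Mono (@mono_ofP m n f fnd).

Lemma monoP m n (f : mono m n) (i j : 'I_m.+1) : (i <= j)%N -> (f i <= f j)%N.
Proof. by case: f => f /= /forallP/(_ i)/forallP/(_ j)/implyP; apply. Qed.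

Definition mono_id n : mono n n := mono_of (f := id) (fun i j ij => ij).

Definition mono_comp m n r (g : mono n r) (f : mono m n) : mono m r :=
  mono_of (f := g \o f) (fun i j ij => monoP g (monoP f ij)).

Lemma lift_nd n (i : 'I_n.+2) (x y : 'I_n.+1) :
  (x <= y)%N -> (lift i x <= lift i y)%N.
Proof. by move=> xy; rewrite /= leq_bump2. Qed.

(* epsilon_i *)
Definition mono_face n (i : 'I_n.+2) : mono n n.+1 :=
  mono_of (@lift_nd n i).

(* [None] stands for the empty set. *)
Record d2hom k l k' l' := D2hom {
  ha : option (mono k k');
  hb : option (mono l k');
  hc : mono l l';
  hab : (ha == None) || (hb == None)
}.

Lemma d2hom_eq k l k' l' (f g : d2hom k l k' l') :
  ha f = ha g -> hb f = hb g -> hc f = hc g -> f = g.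
Proof.
case: f g => [a b c p] [a' b' c' p'] /= ea eb ec.
by case: _ / ea p'; case: _ / eb; case: _ / ec => p';
  congr D2hom; exact: eq_irrelevance.
Qed.

Definition d2id k l : d2hom k l k l :=
  @D2hom k l k l (Some (mono_id k)) None (mono_id l) isT.

Definition omono_comp m n r (g : option (mono n r)) (f : option (mono m n)) :=
  if g is Some g' then omap (mono_comp g') f else None.

Lemma d2comp_subproof k l k' l' k2 l2
    (f2 : d2hom k' l' k2 l2) (f : d2hom k l k' l') :
  (omono_comp (ha f2) (ha f) == None) ||
  ((if hb f2 is Some b2 then Some (mono_comp b2 (hc f))
    else omono_comp (ha f2) (hb f)) == None).
Proof.
by case: f2 f => [[a2|] [b2|] c2 //= _] [[a|] [b|] c //= _].
Qed.

(* The three composition rules at once; with [hb f2 = None] and [ha f2 = None]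
   the second component is empty, as both applicable rules prescribe. *)
Definition d2comp k l k' l' k2 l2
    (f2 : d2hom k' l' k2 l2) (f : d2hom k l k' l') : d2hom k l k2 l2 :=
  @D2hom k l k2 l2
    (omono_comp (ha f2) (ha f))
    (if hb f2 is Some b2 then Some (mono_comp b2 (hc f))
     else omono_comp (ha f2) (hb f))
    (mono_comp (hc f2) (hc f))
    (d2comp_subproof f2 f).

Definition oconst m n (a : option (mono m n)) : bool :=
  if a is Some a' then [forall i, a' i == a' ord0] else true.

(** ** The Delta_2-space of a crossed module *)

(* (u_{i+1}, ..., u_j), for a tuple u_1, ..., u_n stored with indices from 0 *)
Definition slice T n (u : 'I_n -> T) (i j : nat) : seq T :=
  drop i (take j (codom u)).

Lemma slice_nn T n (u : 'I_n -> T) i : slice u i i = [::].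
Proof. by rewrite /slice drop_oversize // size_take; case: ltnP. Qed.

Lemma slice_rcons T n (u : 'I_n -> T) i (j : 'I_n) :
  (i <= j)%N -> slice u i j.+1 = rcons (slice u i j) (u j).
Proof.
move=> ij; have jn : (j < size (codom u))%N by rewrite size_codom card_ord.
rewrite /slice (take_nth (u j)) // drop_rcons; last first.
  by rewrite size_take jn.
congr rcons; rewrite codomE (nth_map j) ?size_enum_ord //.
by rewrite nth_ord_enum.
Qed.

Section D2space.
Variables (G0 N1 G1 : topologicalType) (cm : crossed_module G0 N1 G1).
Let N := cmN cm.
Let G := cmG cm.

Definition vertex_of l (v : G0) (g : 'I_l -> G1) (i : 'I_l.+1) : G0 :=
  if unlift ord0 i is Some j then gsrc G (g j) else v.

(* A point (x_1..x_k; g_1..g_l) is stored with its base object v = t(x_i) =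
   t(g_1), which the tuple determines when k + l > 0; for k = l = 0 the space
   is the space of objects.  The case k = 0 is the nerve of the groupoid. *)
Definition NGset k l :
    set (G0 * ({ptws 'I_k -> N1} * {ptws 'I_l -> G1})) :=
  [set p | (forall i, gtgt N (p.2.1 i) = p.1) /\
           (forall i : 'I_l, gtgt G (p.2.2 i) =
              vertex_of p.1 p.2.2 (widen_ord (leqnSn l) i))].

Definition NG k l : topologicalType := set_type (@NGset k l).

Section Points.
Variables (k l : nat) (p : NG k l).
Definition base : G0 := (val p).1.
Definition xs : 'I_k -> N1 := (val p).2.1.
Definition gs : 'I_l -> G1 := (val p).2.2.
(* t(g_1) for i = 0, and s(g_i) for i > 0 *)
Definition vertex (i : 'I_l.+1) : G0 := vertex_of base gs i.
(* x_{i+1} ... x_j *)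
Definition xprod (i j : 'I_k.+1) : N1 := gprod N base (slice xs i j).
(* g_{i+1} ... g_j *)
Definition gsprod (i j : 'I_l.+1) : G1 := gprod G (vertex i) (slice gs i j).
End Points.

Section PointsTheory.
Variables (k l : nat) (p : NG k l).

Lemma gtgt_xs i : gtgt N (xs p i) = base p.
Proof. exact: (set_mem (valP p)).1. Qed.

Lemma gtgt_gs (i : 'I_l) : gtgt G (gs p i) = vertex p (widen_ord (leqnSn l) i).
Proof. exact: (set_mem (valP p)).2. Qed.

Lemma vertex_lift (i : 'I_l) : vertex p (lift ord0 i) = gsrc G (gs p i).
Proof. by rewrite /vertex /vertex_of liftK. Qed.

Lemma vertex0 : vertex p ord0 = base p.
Proof. by rewrite /vertex /vertex_of unlift_none. Qed.

Lemma gtgt_xprod i j : gtgt N (xprod p i j) = base p.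
Proof.
rewrite /xprod; set s := slice _ _ _.
have: forall x, x \in [seq gtgt N y | y <- s] -> x = base p.
  move=> x /mapP[y /mem_drop/mem_take/codomP[a ->] ->]; exact: gtgt_xs.
elim/last_ind: s => [|s y IH] sP; first by rewrite /gprod /= gtgt_unit.
rewrite /gprod foldl_rcons -/(gprod N (base p) s).
have IHs : gtgt N (gprod N (base p) s) = base p.
  by apply: IH => x xs; apply: sP; rewrite map_rcons mem_rcons inE xs orbT.
rewrite gtgt_mul // cmN_bundle IHs; apply/esym/sP.
by rewrite map_rcons mem_rcons inE eqxx.
Qed.

Lemma gsprodP (i j : 'I_l.+1) : (i <= j)%N ->
  gtgt G (gsprod p i j) = vertex p i /\ gsrc G (gsprod p i j) = vertex p j.
Proof.
rewrite /gsprod; case: j => j /= jl; elim: j jl => [|j IH] jl ij.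
  have -> : i = Ordinal jl by apply/val_inj/eqP; rewrite /= -leqn0.
  by rewrite slice_nn /gprod /= gtgt_unit gsrc_unit.
move: ij; rewrite leq_eqVlt => /orP[/eqP ij|]; last rewrite ltnS => ij.
  have -> : i = Ordinal jl by exact/val_inj.
  by rewrite slice_nn /gprod /= gtgt_unit gsrc_unit.
have jl' : (j < l)%N by [].
rewrite (@slice_rcons _ _ _ _ (Ordinal jl')) // /gprod foldl_rcons.
have [t0 s0] := IH (ltnW jl) ij.
have st : gsrc G (gprod G (vertex p i) (slice (gs p) i j)) =
          gtgt G (gs p (Ordinal jl')).
  by rewrite s0 gtgt_gs; congr vertex; apply: val_inj.
rewrite gtgt_mul // gsrc_mul //; split=> //.
by rewrite -vertex_lift; congr vertex; apply: val_inj.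
Qed.
End PointsTheory.

Section Tilde.
Variables (k l k' l' : nat) (f : d2hom k l k' l') (p : NG k' l').

Definition tilde_base : G0 := vertex p (hc f ord0).

(* The indices of the source run from 1: the entry i of the source is stored
   at j : 'I_k with i - 1 = widen_ord _ j and i = lift ord0 j. *)
Definition tilde_xs (j : 'I_k) : N1 :=
  if ha f is Some a then
    cm_act cm (xprod p (a (widen_ord (leqnSn k) j)) (a (lift ord0 j)))
           (gsprod p ord0 (hc f ord0))
  else gunit N tilde_base.

(* When b is empty it is read as a constant map, and the first factor, which
   is then a unit, is omitted. *)
Definition tilde_gs (j : 'I_l) : G1 :=
  let j0 := widen_ord (leqnSn l) j in let j1 := lift ord0 j in
  let g := gsprod p (hc f j0) (hc f j1) in
  if hb f is Some b then
    gmul G (gconj G (phi cm (xprod p (b j0) (b j1))) (gsprod p ord0 (hc f j0)))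
           g
  else g.
Lemma tilde_gsP (j : 'I_l) :
  gtgt G (tilde_gs j) = vertex p (hc f (widen_ord (leqnSn l) j)) /\
  gsrc G (tilde_gs j) = vertex p (hc f (lift ord0 j)).
Proof.
rewrite /tilde_gs; set j0 := widen_ord _ j; set j1 := lift ord0 j.
have j01 : (hc f j0 <= hc f j1)%N.
  by apply: monoP; rewrite /j1 /bump /= leqnSn.
have [t1 s1] := gsprodP p j01.
case: (hb f) => [b|] //.
have [t0 s0] := @gsprodP _ _ p ord0 (hc f j0) (leq0n _).
rewrite vertex0 in t0; set g := gsprod p ord0 _ in t0 s0 *.
have tx := gtgt_xprod p (b j0) (b j1); set x := xprod p _ _ in tx *.
have c1 : gsrc G (ginv G g) = gtgt G (phi cm x).
  by rewrite gsrc_inv gtgt_phi tx.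
have c2 : gsrc G (gmul G (ginv G g) (phi cm x)) = gtgt G g.
  by rewrite gsrc_mul // gsrc_phi cmN_bundle tx.
have tc : gtgt G (gconj G (phi cm x) g) = vertex p (hc f j0).
  by rewrite /gconj gtgt_mul // gtgt_mul // gtgt_inv.
have sc : gsrc G (gconj G (phi cm x) g) = vertex p (hc f j0).
  by rewrite /gconj gsrc_mul.
have cc : gsrc G (gconj G (phi cm x) g) =
          gtgt G (gsprod p (hc f j0) (hc f j1)) by rewrite sc t1.
by rewrite (gtgt_mul cc) (gsrc_mul cc).
Qed.

Lemma tilde_subproof :
  (tilde_base, (tilde_xs : {ptws 'I_k -> N1}, tilde_gs : {ptws 'I_l -> G1}))
    \in @NGset k l.
Proof.
apply/mem_set; split=> /= i.
  rewrite /tilde_xs; case: (ha f) => [a|]; last by rewrite gtgt_unit.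
  have [t0 s0] := @gsprodP _ _ p ord0 (hc f ord0) (leq0n _).
  by rewrite gtgt_cm_act // gtgt_xprod t0 vertex0.
rewrite (tilde_gsP i).1 /vertex_of; case: unliftP => [j ->|-> //].
by rewrite (tilde_gsP j).2.
Qed.

Definition tilde : NG k l := exist (fun q => q \in @NGset k l) _ tilde_subproof.
End Tilde.
End D2space.

(* f |-> tilde f is a contravariant functor. *)
Section GroupoidTheory.
Variables (G0 G1 : topologicalType) (G : groupoid G0 G1).

Lemma gmul_unitl v g : gtgt G g = v -> gmul G (gunit G v) g = g.
Proof. by move=> <-; rewrite gmul1g. Qed.

Lemma gmul_unitr v g : gsrc G g = v -> gmul G g (gunit G v) = g.
Proof. by move=> <-; rewrite gmulg1. Qed.

Lemma gmulKg g h : gsrc G g = gtgt G h -> gmul G (ginv G g) (gmul G g h) = h.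
Proof. by move=> gh; rewrite gmulA ?gsrc_inv // gmulVg gmul_unitl. Qed.

Lemma gmulKVg g h : gtgt G g = gtgt G h -> gmul G g (gmul G (ginv G g) h) = h.
Proof. by move=> gh; rewrite gmulA ?gsrc_inv ?gtgt_inv // gmulgV gmul_unitl. Qed.

Lemma gmul_injl g h h' : gsrc G g = gtgt G h -> gsrc G g = gtgt G h' ->
  gmul G g h = gmul G g h' -> h = h'.
Proof. by move=> gh gh' e; rewrite -(gmulKg gh) e gmulKg. Qed.

Lemma gidem g : gsrc G g = gtgt G g -> gmul G g g = g -> g = gunit G (gtgt G g).
Proof.
move=> st gg; apply: (@gmul_injl g); rewrite ?gtgt_unit //.
by rewrite gg gmul_unitr.
Qed.

Lemma gsrc_conj h g : gsrc G h = gtgt G g -> gtgt G h = gtgt G g ->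
  gsrc G (gconj G h g) = gsrc G g.
Proof.
move=> hs ht; rewrite /gconj gsrc_mul // gsrc_mul ?hs //.
by rewrite gsrc_inv.
Qed.

Lemma gtgt_conj h g : gsrc G h = gtgt G g -> gtgt G h = gtgt G g ->
  gtgt G (gconj G h g) = gsrc G g.
Proof.
move=> hs ht; have e : gsrc G (ginv G g) = gtgt G h by rewrite gsrc_inv.
by rewrite /gconj gtgt_mul ?gsrc_mul // gtgt_mul // gtgt_inv.
Qed.

(* g * (h^g * r) = h * (g * r) *)
Lemma gmul_conj h g r : gsrc G h = gtgt G g -> gtgt G h = gtgt G g ->
  gsrc G g = gtgt G r ->
  gmul G g (gmul G (gconj G h g) r) = gmul G h (gmul G g r).
Proof.
move=> hs ht gr; have e : gsrc G (ginv G g) = gtgt G h by rewrite gsrc_inv.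
rewrite /gconj -(@gmulA _ _ _ _ g r) ?gsrc_mul //.
rewrite -(@gmulA _ _ _ _ h) ?gtgt_mul // gmulKVg // gtgt_mul ?gtgt_mul //.
Qed.

Lemma gconj_unit g : gconj G (gunit G (gtgt G g)) g = gunit G (gsrc G g).
Proof. by rewrite /gconj gmul_unitr ?gsrc_inv // gmulVg. Qed.

Lemma gprod_rcons v u g : gprod G v (rcons u g) = gmul G (gprod G v u) g.
Proof. by rewrite /gprod foldl_rcons. Qed.
End GroupoidTheory.

Section D2Functor.
Variables (G0 N1 G1 : topologicalType) (cm : crossed_module G0 N1 G1).
Let N := cmN cm.
Let G := cmG cm.

Lemma NG_eq k l (p q : NG cm k l) : base p = base q ->
  (forall i, xs p i = xs q i) -> (forall i, gs p i = gs q i) -> p = q.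
Proof.
move=> eb ex eg.
have {}ex : xs p = xs q by exact: functional_extensionality_dep.
have {}eg : gs p = gs q by exact: functional_extensionality_dep.
apply: val_inj; move: eb ex eg; rewrite /base /xs /gs.
by case: (val p) => [? []] ? ?; case: (val q) => [? []] ? ? /= -> -> ->.
Qed.

Section Point.
Variables (k l : nat) (p : NG cm k l).

Lemma gsprod_nn i : gsprod p i i = gunit G (vertex p i).
Proof. by rewrite /gsprod slice_nn. Qed.

Lemma xprod_nn i : xprod p i i = gunit N (base p).
Proof. by rewrite /xprod slice_nn. Qed.

Lemma gsprodS (i : 'I_l.+1) (j : 'I_l) : (i <= j)%N ->
  gsprod p i (lift ord0 j) =
  gmul G (gsprod p i (widen_ord (leqnSn l) j)) (gs p j).
Proof.
by move=> ij; rewrite /gsprod lift0 slice_rcons //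
  gprod_rcons.
Qed.

Lemma xprodS (i : 'I_k.+1) (j : 'I_k) : (i <= j)%N ->
  xprod p i (lift ord0 j) =
  gmul N (xprod p i (widen_ord (leqnSn k) j)) (xs p j).
Proof.
by move=> ij; rewrite /xprod lift0 slice_rcons //
  gprod_rcons.
Qed.
End Point.

Lemma ord_nd_ind n (i : 'I_n.+1) (P : 'I_n.+1 -> Prop) : P i ->
  (forall j : 'I_n, (i <= j)%N -> P (widen_ord (leqnSn n) j) ->
     P (lift ord0 j)) ->
  forall j : 'I_n.+1, (i <= j)%N -> P j.
Proof.
move=> Pi PS [j jn]; elim: j jn => [|j IH] jn /= ij.
  by have -> : Ordinal jn = i by apply/val_inj/esym/eqP; rewrite -leqn0.
move: ij; rewrite leq_eqVlt => /orP[/eqP ij|ij].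
  by have -> : Ordinal jn = i by exact/val_inj/esym.
have jn' : (j < n)%N by [].
have -> : Ordinal jn = lift ord0 (Ordinal jn') by exact: val_inj.
apply: PS => //.
by have -> : widen_ord (leqnSn n) (Ordinal jn') = Ordinal (ltnW jn); [exact: val_inj|apply: IH].
Qed.

Lemma leq_ord0 n (i : 'I_n.+1) : (@ord0 n <= i)%N. Proof. by []. Qed.

Section Point2.
Variables (k l : nat) (p : NG cm k l).

Lemma gsprod_cat (i j m : 'I_l.+1) : (i <= j)%N -> (j <= m)%N ->
  gmul G (gsprod p i j) (gsprod p j m) = gsprod p i m.
Proof.
move=> ij; move: m; apply: ord_nd_ind => [|m jm IH].
  by rewrite gsprod_nn gmul_unitr // (gsprodP p ij).2.
rewrite !gsprodS ?(leq_trans ij) // -IH gmulA //.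
  by rewrite (gsprodP p ij).2 (@gsprodP _ _ _ _ _ _ p j (widen_ord _ m) jm).1.
by rewrite (@gsprodP _ _ _ _ _ _ p j (widen_ord _ m) jm).2 gtgt_gs.
Qed.

Lemma gsrc_xprod i j : gsrc N (xprod p i j) = base p.
Proof. by rewrite cmN_bundle gtgt_xprod. Qed.

Lemma xprod_cat (i j m : 'I_k.+1) : (i <= j)%N -> (j <= m)%N ->
  gmul N (xprod p i j) (xprod p j m) = xprod p i m.
Proof.
move=> ij; move: m; apply: ord_nd_ind => [|m jm IH].
  by rewrite xprod_nn gmul_unitr // gsrc_xprod.
rewrite !xprodS ?(leq_trans ij) // -IH gmulA ?gsrc_xprod ?gtgt_xprod //.
by rewrite gtgt_xs.
Qed.
End Point2.

Lemma cm_act_unit g : cm_act cm (gunit N (gtgt G g)) g = gunit N (gsrc G g).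
Proof.
have t : gtgt N (gunit N (gtgt G g)) = gtgt G g by rewrite gtgt_unit.
have := gtgt_cm_act t; set y := cm_act _ _ _ => ty.
rewrite -ty; apply: gidem; first by rewrite cmN_bundle.
by rewrite /y -cm_act_mul // gmul_unitl // gtgt_unit.
Qed.

Section TildeTheory.
Variables (k l k' l' : nat) (f : d2hom k l k' l') (p : NG cm k' l').

Lemma base_tilde : base (tilde f p) = vertex p (hc f ord0). Proof. by []. Qed.

Lemma vertex_tilde i : vertex (tilde f p) i = vertex p (hc f i).
Proof.
rewrite /vertex /vertex_of; case: unliftP => [j ->|-> //].
exact: (tilde_gsP f p j).2.
Qed.

Lemma xprod_tilde (i j : 'I_k.+1) : (i <= j)%N ->
  xprod (tilde f p) i j =
  if ha f is Some a then cm_act cm (xprod p (a i) (a j)) (gsprod p ord0 (hc f ord0))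
  else gunit N (vertex p (hc f ord0)).
Proof.
have [t0 s0] := @gsprodP _ _ _ _ _ _ p ord0 (hc f ord0) (leq0n _).
move: j; apply: ord_nd_ind => [|j ij IH].
  rewrite xprod_nn base_tilde; case: (ha f) => [a|] //.
  by rewrite xprod_nn -vertex0 -t0 cm_act_unit s0.
rewrite xprodS // IH {IH}.
change (xs (tilde f p) j) with (tilde_xs f p j); rewrite /tilde_xs.
case: (ha f) => [a|]; last by rewrite gmul_unitl // gtgt_unit.
rewrite -cm_act_mul ?gtgt_xprod ?t0 ?vertex0 // xprod_cat //; exact: monoP.
Qed.

Lemma gsprod_tilde (i j : 'I_l.+1) : (i <= j)%N ->
  gsprod (tilde f p) i j =
  if hb f is Some b then
    gmul G (gconj G (phi cm (xprod p (b i) (b j))) (gsprod p ord0 (hc f i)))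
           (gsprod p (hc f i) (hc f j))
  else gsprod p (hc f i) (hc f j).
Proof.
have [t0 s0] := @gsprodP _ _ _ _ _ _ p ord0 (hc f i) (leq0n _).
rewrite vertex0 in t0.
move: j; apply: ord_nd_ind => [|j ij IH].
  rewrite !gsprod_nn vertex_tilde; case: (hb f) => [b|] //.
  rewrite xprod_nn phi_unit gmul_unitr; last first.
    by rewrite gsrc_conj ?gsrc_unit ?gtgt_unit.
  rewrite /gconj gmul_unitr ?gsrc_inv ?t0 // gmulVg s0 //.
set j0 := widen_ord _ j in IH *.
have jj : (hc f j0 <= hc f (lift ord0 j))%N.
  by apply: monoP; rewrite /= /bump /= leqnSn.
have ij' : (hc f i <= hc f j0)%N by apply: monoP.
have [t1 s1] := gsprodP p ij'.
have [t2 s2] := gsprodP p jj.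
rewrite gsprodS // -/j0 IH {IH}.
change (gs (tilde f p) j) with (tilde_gs f p j); rewrite /tilde_gs -/j0.
case: (hb f) => [b|]; last by rewrite gsprod_cat.
have bb : (b j0 <= b (lift ord0 j))%N.
  by apply: monoP; rewrite /= /bump /= leqnSn.
have bi : (b i <= b j0)%N by apply: monoP.
rewrite -(gsprod_cat p (leq_ord0 _) ij') -(xprod_cat p bi bb).
rewrite phi_mul ?gtgt_xprod // -(gsprod_cat p ij' jj).
have sx u v : gsrc G (phi cm (xprod p u v)) = base p.
  by rewrite gsrc_phi gsrc_xprod.
have tx u v : gtgt G (phi cm (xprod p u v)) = base p.
  by rewrite gtgt_phi gtgt_xprod.
move: (sx (b i) (b j0)) (tx (b i) (b j0)).
move: (sx (b j0) (b (lift ord0 j))) (tx (b j0) (b (lift ord0 j))).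
set x := phi cm (xprod p (b i) _); set y := phi cm (xprod p (b j0) _).
move: t0 s0 t1 s1 t2 s2; rewrite -/G.
set g := gsprod p ord0 _; set h := gsprod p _ (hc f j0).
set r := gsprod p _ (hc f (lift _ _)).
move: x y g h r => x y g h r t0 s0 t1 s1 t2 s2 sy ty sx' tx'.
have xc : gtgt G (gconj G x g) = gsrc G g by rewrite gtgt_conj ?sx' ?tx' ?t0.
have xc' : gsrc G (gconj G x g) = gsrc G g by rewrite gsrc_conj ?sx' ?tx' ?t0.
have gh : gsrc G g = gtgt G h by rewrite s0.
have hr : gsrc G h = gtgt G r by rewrite s1.
have sgh : gsrc G (gmul G g h) = gtgt G r by rewrite gsrc_mul.
have tgh : gtgt G (gmul G g h) = gtgt G g by rewrite gtgt_mul.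
have yc : gtgt G (gconj G y (gmul G g h)) = gtgt G r.
  by rewrite gtgt_conj ?sy ?ty ?tgh ?t0.
have yc' : gsrc G (gconj G y (gmul G g h)) = gtgt G r.
  by rewrite gsrc_conj ?sy ?ty ?tgh ?t0.
have xy : gsrc G x = gtgt G y by rewrite sx' ty.
have sxy : gsrc G (gmul G x y) = gtgt G g by rewrite gsrc_mul // sy.
have txy : gtgt G (gmul G x y) = gtgt G g by rewrite gtgt_mul // tx'.
have xyc : gtgt G (gconj G (gmul G x y) g) = gsrc G g by rewrite gtgt_conj.
have xyc' : gsrc G (gconj G (gmul G x y) g) = gsrc G g by rewrite gsrc_conj.
have xh : gsrc G (gconj G x g) = gtgt G h by rewrite xc'.
have yr : gsrc G (gconj G y (gmul G g h)) = gtgt G r by rewrite yc'.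
have hyr : gsrc G h = gtgt G (gmul G (gconj G y (gmul G g h)) r).
  by rewrite gtgt_mul // yc.
have thr : gtgt G (gmul G h r) = gtgt G h by rewrite gtgt_mul.
rewrite -(gmulA xh hyr).
have shyr : gtgt G (gmul G h (gmul G (gconj G y (gmul G g h)) r)) = gsrc G g.
  by rewrite gtgt_mul.
apply: (@gmul_injl _ _ G g).
- by rewrite gtgt_mul ?shyr.
- by rewrite gtgt_mul ?thr // xyc'.
rewrite !gmul_conj ?shyr ?thr ?sxy ?txy ?sx' ?tx' ?t0 //.
rewrite (gmulA gh hyr) gmul_conj ?sy ?ty ?tgh ?t0 //.
have gr : gsrc G y = gtgt G (gmul G (gmul G g h) r).
  by rewrite gtgt_mul // tgh t0 sy.
by rewrite (gmulA xy gr) -(gmulA gh hr).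
Qed.
End TildeTheory.

Lemma tilde_id k l (p : NG cm k l) : tilde (d2id k l) p = p.
Proof.
apply: NG_eq.
- by rewrite base_tilde /= ffunE vertex0.
- move=> i; change (tilde_xs (d2id k l) p i = xs p i).
  rewrite /tilde_xs /= !ffunE xprodS // xprod_nn gsprod_nn.
  rewrite gmul_unitl ?gtgt_xs // vertex0 -(gtgt_xs p i); exact: cm_act1.
- move=> i; change (tilde_gs (d2id k l) p i = gs p i).
  rewrite /tilde_gs /= !ffunE gsprodS // gsprod_nn gmul_unitl //; exact: gtgt_gs.
Qed.

Lemma tilde_comp k l k' l' k2 l2 (f : d2hom k l k' l') (f2 : d2hom k' l' k2 l2)
  (p : NG cm k2 l2) : tilde (d2comp f2 f) p = tilde f (tilde f2 p).
Proof.
have le1 n (j : 'I_n) : (widen_ord (leqnSn n) j <= lift ord0 j)%N.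
  by rewrite /= /bump /= leqnSn.
have [t0 s0] := @gsprodP _ _ _ _ _ _ p ord0 (hc f2 ord0) (leq_ord0 _).
have c0 : (hc f2 ord0 <= hc f2 (hc f ord0))%N by apply: monoP.
have [t1 s1] := gsprodP p c0.
apply: NG_eq.
- by rewrite !base_tilde vertex_tilde /= ffunE.
- move=> i; change (tilde_xs (d2comp f2 f) p i = tilde_xs f (tilde f2 p) i).
  have tE : tilde_base (d2comp f2 f) p = vertex p (hc f2 (hc f ord0)).
    by rewrite /tilde_base /= ffunE.
  have tE' : tilde_base f (tilde f2 p) = vertex p (hc f2 (hc f ord0)).
    by rewrite /tilde_base vertex_tilde.
  rewrite /tilde_xs tE tE' /=; case ea : (ha f) => [a|] /=; last first.
    by case: (ha f2).
  rewrite xprod_tilde ?gsprod_tilde //; last by apply: monoP.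
  case: f2 t0 s0 c0 t1 s1 tE tE' => -[a2|] [b2|] c2 //= _ t0 s0 c0 t1 s1 _ _.
  + rewrite !ffunE /= -(gsprod_cat p (leq_ord0 _) c0) cm_actM //.
      by rewrite gtgt_xprod t0 vertex0.
    by rewrite s0 t1.
  + set h := gmul _ _ _; have [th sh] : gtgt G h = vertex p (c2 ord0) /\
      gsrc G h = vertex p (c2 (hc f ord0)).
      have := gsprodP (tilde (@D2hom k' l' k2 l2 None (Some b2) c2 isT) p)
                     (leq_ord0 (hc f ord0)).
      by rewrite gsprod_tilde //= !vertex_tilde /=.
    by rewrite -sh -th cm_act_unit.
  + by rewrite -s1 -t1 cm_act_unit.
- move=> i; change (tilde_gs (d2comp f2 f) p i = tilde_gs f (tilde f2 p) i).
  rewrite /tilde_gs /= !ffunE.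
  set i0 := widen_ord _ i; set i1 := lift ord0 i.
  have c01 : (hc f i0 <= hc f i1)%N by apply: monoP; apply: le1.
  rewrite (gsprod_tilde f2 p c01).
  case eb : (hb f) => [b|]; last first.
    by case: (hb f2) => [b2|]; rewrite ?ffunE //; case: (ha f2).
  have b01 : (b i0 <= b i1)%N by apply: monoP; apply: le1.
  rewrite (xprod_tilde f2 p b01) (gsprod_tilde f2 p (leq_ord0 _)).
  case: f2 {t0 s0 t1 s1} c0 c01 => -[a2|] [b2|] c2 //= _ c0 c01.
  + have ci : (c2 ord0 <= c2 (hc f i0))%N by apply: monoP.
    have [t2 s2] := @gsprodP _ _ _ _ _ _ p ord0 (c2 ord0) isT.
    have [t3 s3] := gsprodP p ci.
    rewrite vertex0 in t2; rewrite !ffunE -(gsprod_cat p (leq_ord0 _) ci).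
    by rewrite -!phi_cm_act ?cm_actM ?gtgt_xprod ?gtgt_cm_act ?gtgt_mul
      ?gtgt_xprod ?t2 ?s2 ?t3.
  + have := gsprodP (tilde (@D2hom k' l' k2 l2 None (Some b2) c2 isT) p)
                    (leq_ord0 (hc f i0)).
    have := gsprodP (tilde (@D2hom k' l' k2 l2 None (Some b2) c2 isT) p) c01.
    rewrite !gsprod_tilde //= !vertex_tilde /= -/G.
    move=> [t2 s2] [t3 s3]; rewrite !ffunE -t3 phi_unit gconj_unit s3.
    by rewrite gmul_unitl // t2.
  + have ci : (c2 ord0 <= c2 (hc f i0))%N by apply: monoP.
    have [t3 s3] := gsprodP p ci; have [t2 s2] := gsprodP p (monoP c2 c01).
    by rewrite -t3 phi_unit gconj_unit s3 gmul_unitl.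
Qed.
End D2Functor.

(** ** Abelian sheaves *)

Record opens (X : topologicalType) := Opens {
  opens_set :> set X;
  opens_open : open opens_set
}.

Definition opens_top (X : topologicalType) : opens X := Opens (@openT X).

Definition opens_cap (X : topologicalType) (U V : opens X) : opens X :=
  Opens (openI (opens_open U) (opens_open V)).

Record ab_sheaf (X : topologicalType) := AbSheaf {
  sections :> opens X -> zmodType;
  rst : forall U V : opens X, V `<=` U -> {additive sections U -> sections V};
  rst_id : forall (U : opens X) (h : U `<=` U) s, rst h s = s;
  rst_comp : forall (U V W : opens X) (h : V `<=` U) (h' : W `<=` V) (h2 : W `<=` U) s,
    rst h2 s = rst h' (rst h s);
  rst_glue : forall (U : opens X) (I : Type) (F : I -> opens X)
      (hF : forall i, F i `<=` U) (s : forall i, sections (F i)),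
    U `<=` \bigcup_i F i ->
    (forall i j, rst (V := opens_cap (F i) (F j)) (@subIsetl _ _ _) (s i) =
                 rst (V := opens_cap (F i) (F j)) (@subIsetr _ _ _) (s j)) ->
    exists! t : sections U, forall i, rst (hF i) t = s i
}.

Arguments rst {X} a {U V} _.

Section Sheaves.
Variables (G0 N1 G1 : topologicalType) (cm : crossed_module G0 N1 G1).

(* Functoriality includes compatibility with restrictions, since [pull] along
   an identity is a restriction.
   [pull_const]: by the convention that the empty set is read as a constant
   map, the morphisms (a, b, c) for which each of a and b is empty or constant
   all induce the same map of spaces once c is fixed, and the restriction map
   is attached to that map of spaces. Without it the shuffle formula does not
   give the identity in degree k = 0, nor a map on the cohomology of
   [row_complex A 1] for k = 1. *)
Record d2sheaf := D2sheaf {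
  dsh :> forall k l, ab_sheaf (NG cm k l);
  pull : forall k l k' l' (f : d2hom k l k' l')
      (U : opens (NG cm k l)) (V : opens (NG cm k' l')),
    tilde f @` V `<=` U -> {additive dsh k l U -> dsh k' l' V};
  pull_id : forall k l (U V : opens (NG cm k l))
      (h : tilde (d2id k l) @` V `<=` U) (h' : V `<=` U) s,
    pull h s = rst (dsh k l) h' s;
  pull_comp : forall k l k' l' k2 l2
      (f : d2hom k l k' l') (f2 : d2hom k' l' k2 l2)
      (U : opens (NG cm k l)) (V : opens (NG cm k' l'))
      (W : opens (NG cm k2 l2)) (h : tilde f @` V `<=` U)
      (h' : tilde f2 @` W `<=` V) (h2 : tilde (d2comp f2 f) @` W `<=` U) s,
    pull h2 s = pull h' (pull h s);
  pull_const : forall k l k' l' (f g : d2hom k l k' l')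
      (U : opens (NG cm k l)) (V : opens (NG cm k' l'))
      (hf : tilde f @` V `<=` U) (hg : tilde g @` V `<=` U) s,
    oconst (ha f) -> oconst (hb f) -> oconst (ha g) -> oconst (hb g) ->
    hc f = hc g -> pull hf s = pull hg s
}.

Arguments pull d {k l k' l' f U V} _ : rename.

Record d2complex := D2complex {
  csh :> nat -> d2sheaf;
  cdif : forall q k l (U : opens (NG cm k l)),
    {additive csh q k l U -> csh q.+1 k l U};
  cdif_pull : forall q k l k' l' (f : d2hom k l k' l')
      (U : opens (NG cm k l)) (V : opens (NG cm k' l'))
      (h : tilde f @` V `<=` U) s,
    cdif q V (pull (csh q) h s) = pull (csh q.+1) h (cdif q U s);
  cdif2 : forall q k l (U : opens (NG cm k l)) s,
    cdif q.+1 U (cdif q U s) = 0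
}.

(* A_q(N_k x| Gamma_l) *)
Definition gsec (A : d2complex) q k l : zmodType := A q k l (opens_top _).

Definition pullT (A : d2complex) q k l k' l' (f : d2hom k l k' l') :
  {additive gsec A q k l -> gsec A q k' l'} :=
  pull (A q) (U := opens_top _) (V := opens_top _) (f := f) (@subsetT _ _).
End Sheaves.

(** ** Cochain complexes and their cohomology *)

Record cochain_complex := CochainComplex {
  cochains :> nat -> zmodType;
  cd : forall n, {additive cochains n -> cochains n.+1};
  cd2 : forall n c, cd n.+1 (cd n c) = 0
}.

Definition coboundary (C : cochain_complex) n : C n -> Prop :=
  match n return C n -> Prop with
  | 0 => fun z => z = 0
  | m.+1 => fun z => exists c, z = cd C m c
  end.

Lemma coboundary0 (C : cochain_complex) n : @coboundary C n 0.
Proof. by case: n => [//|n]; exists 0; rewrite raddf0. Qed.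

Lemma coboundaryB (C : cochain_complex) n (x y : C n) :
  coboundary x -> coboundary y -> coboundary (x - y).
Proof.
case: n x y => [|n] x y /=; first by move=> -> ->; rewrite subrr.
by move=> [a ->] [b ->]; exists (a - b); rewrite raddfB.
Qed.

Section Cohomology.
Variables (C : cochain_complex) (n : nat).

Definition cocycle : {pred C n} := [pred z | cd C n z == 0].

Lemma cocycle_zmod_closed : zmod_closed cocycle.
Proof.
split=> [|x y]; rewrite !inE ?raddf0 // => /eqP hx /eqP hy.
by rewrite raddfB hx hy subrr.
Qed.
HB.instance Definition _ :=
  GRing.isZmodClosed.Build (C n) cocycle cocycle_zmod_closed.

Record cocycles : Type := Cocycle { cval :> C n; cvalP : cval \in cocycle }.
HB.instance Definition _ := [isSub for cval].
HB.instance Definition _ := [Choice of cocycles by <:].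
HB.instance Definition _ := [SubChoice_isSubZmodule of cocycles by <:].

Definition Bpred : {pred cocycles} := [pred z : cocycles | `[< coboundary (val z) >]].

Lemma Bpred_zmod_closed : zmod_closed Bpred.
Proof.
split=> [|x y]; rewrite !inE; first by rewrite raddf0; exact: coboundary0.
by move=> hx hy; rewrite raddfB; exact: coboundaryB.
Qed.
HB.instance Definition _ := GRing.isZmodClosed.Build cocycles Bpred Bpred_zmod_closed.

Definition cohomology : zmodType := Quotient.quot Bpred.
Definition cls (z : cocycles) : cohomology := (\pi_cohomology z)%qT.
End Cohomology.

Definition chain_map (C D : cochain_complex)
    (T : forall n, {additive C n -> D n}) : Prop :=
  forall n c, T n.+1 (cd C n c) = cd D n (T n c).

(* A finite direct sum, as a dependent product. *)
Definition dsum (I : Type) (M : I -> zmodType) := forall i, M i.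

Section DirectSum.
Variables (I : Type) (M : I -> zmodType).
HB.instance Definition _ := gen_eqMixin (dsum M).
HB.instance Definition _ := gen_choiceMixin (dsum M).
Let add (x y : dsum M) : dsum M := fun i => x i + y i.
Let opp (x : dsum M) : dsum M := fun i => - x i.
Let zero : dsum M := fun i => 0.
Lemma dsum_addA : associative add.
Proof. by move=> x y z; apply: functional_extensionality_dep => i; rewrite /add addrA. Qed.
Lemma dsum_addC : commutative add.
Proof. by move=> x y; apply: functional_extensionality_dep => i; rewrite /add addrC. Qed.
Lemma dsum_add0 : left_id zero add.
Proof. by move=> x; apply: functional_extensionality_dep => i; rewrite /add add0r. Qed.
Lemma dsum_addN : left_inverse zero opp add.
Proof. by move=> x; apply: functional_extensionality_dep => i; rewrite /add addNr. Qed.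
HB.instance Definition _ :=
  GRing.isZmodule.Build (dsum M) dsum_addA dsum_addC dsum_add0 dsum_addN.
End DirectSum.

Record bidegree n := Bideg { bi_p : nat; bi_q : nat; bi_eq : (bi_p + bi_q = n)%N }.

Record tridegree n := Trideg {
  tri_k : nat; tri_p : nat; tri_q : nat;
  tri_eq : (tri_k + tri_p + tri_q = n)%N
}.

Lemma alternating_faces (V : zmodType) m (F : nat -> nat -> V) :
  (forall i j, (i <= j)%N -> (j < m)%N -> F j.+1 i = F i j) ->
  \sum_(j < m.+1) \sum_(i < m) F j i *~ ((-1) ^+ i * (-1) ^+ j) = 0.
Proof.
move=> hF; pose G (j i : nat) := F j i *~ ((-1) ^+ i * (-1) ^+ j).
have -> : \sum_(j < m.+1) \sum_(i < m) F j i *~ ((-1) ^+ i * (-1) ^+ j) =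
  \sum_(j < m.+1) \sum_(i < m | (i < j)%N) G j i +
  \sum_(j < m.+1) \sum_(i < m | ~~ (i < j)%N) G j i.
  rewrite -big_split /=; apply: eq_bigr => j _.
  by rewrite [LHS](bigID (fun i : 'I_m => (i < j)%N)).
rewrite (exchange_big_dep xpredT) //=.
have -> : \sum_(i < m) \sum_(j < m.+1 | (i < j)%N) G j i =
          - \sum_(i < m) \sum_(j < m | (i <= j)%N) G i j.
  rewrite -sumrN; apply: eq_bigr => i _.
  rewrite big_mkcond big_ord_recl /= add0r -big_mkcond /= -sumrN.
  apply: eq_bigr => j ij; rewrite /G /bump /= add1n hF // exprS mulN1r mulrN.
  by rewrite mulrNz mulrC.
rewrite big_ord_recr /=.
have -> : \sum_(i < m | ~~ (i < m)%N) G m i = 0.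
  by rewrite big1 // => i; rewrite ltn_ord.
rewrite addr0.
rewrite addrC; apply/eqP; rewrite subr_eq0; apply/eqP.
by apply: eq_bigr => j _; apply: eq_bigl => i; rewrite -leqNgt.
Qed.

Lemma face_face n (i j : nat) : (i <= j)%N -> (j <= n.+1)%N ->
  mono_comp (mono_face (inord j.+1 : 'I_n.+3)) (mono_face (inord i : 'I_n.+2)) =
  mono_comp (mono_face (inord i : 'I_n.+3)) (mono_face (inord j : 'I_n.+2)).
Proof.
move=> ij jn; apply/val_inj/ffunP => x; rewrite !ffunE /= !ffunE.
have iln := leq_trans ij jn; have iln' := leqW iln.
apply: val_inj; rewrite /= !inordK ?ltnS //.
have e : bump j.+1 i = i by rewrite /bump ltnNge ij.
by rewrite bumpC e /unbump ltnS ij subn1.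
Qed.

Section Complexes.
Variables (G0 N1 G1 : topologicalType) (cm : crossed_module G0 N1 G1).
Variable A : d2complex cm.

Definition hface k p (i : 'I_p.+2) : d2hom k p k p.+1 :=
  @D2hom k p k p.+1 (Some (mono_id k)) None (mono_face i) isT.

Definition vface k p (i : 'I_k.+2) : d2hom k p k.+1 p :=
  @D2hom k p k.+1 p (Some (mono_face i)) None (mono_id p) isT.

Definition ddif q k p (s : gsec A q k p) : gsec A q.+1 k p := cdif A q _ s.

(* the differentials written partial and partial' *)
Definition hdif q k p (s : gsec A q k p) : gsec A q k p.+1 :=
  \sum_(i < p.+2) pullT A q (hface k i) s *~ (-1) ^+ i.

Definition vdif q k p (s : gsec A q k p) : gsec A q k.+1 p :=
  \sum_(i < k.+2) pullT A q (vface p i) s *~ (-1) ^+ i.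

Lemma ddif_is_zmod_morphism q k p : zmod_morphism (@ddif q k p).
Proof. by move=> x y; rewrite /ddif raddfB. Qed.
Lemma hdif_is_zmod_morphism q k p : zmod_morphism (@hdif q k p).
Proof.
move=> x y; rewrite /hdif -sumrB; apply: eq_bigr => i _.
by rewrite raddfB mulrzBl.
Qed.
Lemma vdif_is_zmod_morphism q k p : zmod_morphism (@vdif q k p).
Proof.
move=> x y; rewrite /vdif -sumrB; apply: eq_bigr => i _.
by rewrite raddfB mulrzBl.
Qed.
HB.instance Definition _ q k p :=
  GRing.isZmodMorphism.Build _ _ (@ddif q k p) (@ddif_is_zmod_morphism q k p).
HB.instance Definition _ q k p :=
  GRing.isZmodMorphism.Build _ _ (@hdif q k p) (@hdif_is_zmod_morphism q k p).
HB.instance Definition _ q k p :=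
  GRing.isZmodMorphism.Build _ _ (@vdif q k p) (@vdif_is_zmod_morphism q k p).

Lemma pullT_comp q k l k' l' k2 l2 (f : d2hom k l k' l')
    (f2 : d2hom k' l' k2 l2) (s : gsec A q k l) :
  pullT A q f2 (pullT A q f s) = pullT A q (d2comp f2 f) s.
Proof. exact/esym/pull_comp. Qed.

Lemma ddif_pullT q k l k' l' (f : d2hom k l k' l') (s : gsec A q k l) :
  ddif (pullT A q f s) = pullT A q.+1 f (ddif s).
Proof. exact: cdif_pull. Qed.

Lemma ddif_hdif q k p (s : gsec A q k p) : ddif (hdif s) = hdif (ddif s).
Proof.
rewrite /hdif raddf_sum /=; apply: eq_bigr => i _.
by rewrite raddfMz /= ddif_pullT.
Qed.

Lemma ddif_vdif q k p (s : gsec A q k p) : ddif (vdif s) = vdif (ddif s).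
Proof.
rewrite /vdif raddf_sum /=; apply: eq_bigr => i _.
by rewrite raddfMz /= ddif_pullT.
Qed.

Lemma ddif2 q k p (s : gsec A q k p) : ddif (ddif s) = 0.
Proof. exact: cdif2. Qed.

Lemma mono_comp1 m n (f : mono m n) : mono_comp (mono_id n) f = f.
Proof. by apply/val_inj/ffunP => x; rewrite ffunE /= ffunE. Qed.

Lemma mono_compe m n (f : mono m n) : mono_comp f (mono_id m) = f.
Proof. by apply/val_inj/ffunP => x; rewrite !ffunE /= ffunE. Qed.

Lemma hdif2 q k p (s : gsec A q k p) : hdif (hdif s) = 0.
Proof.
rewrite -[RHS](@alternating_faces _ p.+2 (fun j i =>
  pullT A q (hface k (inord j)) (pullT A q (hface k (inord i)) s))).
  apply: eq_bigr => j _; rewrite raddf_sum /= mulrz_suml; apply: eq_bigr => i _.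
  by rewrite raddfMz -mulrzA !inord_val.
move=> i j ij jp; rewrite !pullT_comp; congr (pullT A q _ s).
by apply: d2hom_eq => //=; rewrite face_face.
Qed.

Lemma vdif2 q k p (s : gsec A q k p) : vdif (vdif s) = 0.
Proof.
rewrite -[RHS](@alternating_faces _ k.+2 (fun j i =>
  pullT A q (vface p (inord j)) (pullT A q (vface p (inord i)) s))).
  apply: eq_bigr => j _; rewrite raddf_sum /= mulrz_suml; apply: eq_bigr => i _.
  by rewrite raddfMz -mulrzA !inord_val.
move=> i j ij jp; rewrite !pullT_comp; congr (pullT A q _ s).
by apply: d2hom_eq => //=; rewrite face_face.
Qed.

Lemma hdif_vdif q k p (s : gsec A q k p) : hdif (vdif s) = vdif (hdif s).
Proof.
rewrite /hdif; under eq_bigr => i _ do rewrite /vdif raddf_sum mulrz_suml.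
rewrite exchange_big /vdif /=; apply: eq_bigr => i _.
rewrite raddf_sum mulrz_suml; apply: eq_bigr => j _.
rewrite !raddfMz -!mulrzA mulrC !pullT_comp; congr (pullT A q _ s *~ _).
by apply: d2hom_eq => //=; rewrite ?mono_comp1 ?mono_compe.
Qed.

Lemma degr_pred m q n : (m + q.+1 = n.+1 -> m + q = n)%N.
Proof. by rewrite addnS => -[]. Qed.

Lemma degl_pred p q n : (p.+1 + q = n.+1 -> p + q = n)%N.
Proof. by rewrite addSn => -[]. Qed.

Lemma degm_pred k p q n : (k + p.+1 + q = n.+1 -> k + p + q = n)%N.
Proof. by rewrite addnS addSn => -[]. Qed.

Lemma degk_pred k p q n : (k.+1 + p + q = n.+1 -> k + p + q = n)%N.
Proof. by rewrite !addSn => -[]. Qed.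

(* C^n((N_k x| Gamma)_*; A_* ) *)
Definition row_cochains k n : zmodType :=
  dsum (fun i : bidegree n => gsec A (bi_q i) k (bi_p i)).

(* The contributions of the differentials to the component of bidegree (p, q);
   they vanish when there is nothing in the preceding degree. *)
Definition row_ddif k n (c : row_cochains k n) p q :
    (p + q = n.+1)%N -> gsec A q k p :=
  if q is q'.+1 return (p + q = n.+1)%N -> gsec A q k p
  then fun e => ddif (c (Bideg (degr_pred e))) else fun _ => 0.

Definition row_hdif k n (c : row_cochains k n) p q :
    (p + q = n.+1)%N -> gsec A q k p :=
  if p is p'.+1 return (p + q = n.+1)%N -> gsec A q k p
  then fun e => hdif (c (Bideg (degl_pred e))) else fun _ => 0.

Definition row_d k n (c : row_cochains k n) : row_cochains k n.+1 := fun i =>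
  row_ddif c (bi_eq i) *~ (-1) ^+ bi_p i + row_hdif c (bi_eq i).

Lemma row_d_is_zmod_morphism k n : zmod_morphism (@row_d k n).
Proof.
move=> x y; apply: functional_extensionality_dep => -[p q e].
change (row_d (x - y) (Bideg e) = row_d x (Bideg e) - row_d y (Bideg e)).
rewrite /row_d /=.
have -> : row_ddif (x - y) e = row_ddif x e - row_ddif y e.
  by case: q e => [|q] e /=; rewrite ?subrr // -raddfB.
have -> : row_hdif (x - y) e = row_hdif x e - row_hdif y e.
  by case: p e => [|p] e /=; rewrite ?subrr // -raddfB.
by rewrite mulrzBl opprD addrACA.
Qed.
HB.instance Definition _ k n :=
  GRing.isZmodMorphism.Build _ _ (@row_d k n) (@row_d_is_zmod_morphism k n).

Lemma row_d2 k n (c : row_cochains k n) : row_d (row_d c) = 0.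
Proof.
apply: functional_extensionality_dep => -[p q e].
change (row_d (row_d c) (Bideg e) = 0).
rewrite /row_d /=.
have irr p' q' (e1 e2 : (p' + q' = n)%N) : c (Bideg e1) = c (Bideg e2).
  by rewrite (eq_irrelevance e1 e2).
case: p e => [|p] e.
  case: q e => [|q] e /=; first by [].
  case: q e => [|q] e /=; rewrite ?mul0rz ?addr0 ?raddf0 //.
  by rewrite raddfMz /= ddif2 !mul0rz.
case: q e => [|q] e /=.
  case: p e => [|p] e /=; rewrite ?mul0rz ?add0r ?raddf0 //.
  by rewrite hdif2.
rewrite /row_d /= !raddfD /= !raddfMz /=.
have -> : ddif (row_ddif c (degr_pred e)) = 0.
  by case: q e => [|q] e /=; rewrite ?raddf0 ?ddif2.
have -> : hdif (row_hdif c (degl_pred e)) = 0.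
  by case: p e => [|p] e /=; rewrite ?raddf0 ?hdif2.
rewrite mul0rz add0r addr0 ddif_hdif (irr _ _ _ (degr_pred (degl_pred e))).
by rewrite exprS mulN1r mulrNz addNr.
Qed.

Definition row_complex k : cochain_complex :=
  @CochainComplex (row_cochains k) (fun n => @row_d k n : {additive _ -> _})
    (@row_d2 k).

(* C^n((N x| Gamma)_**; A_* ) *)
Definition tot_cochains n : zmodType :=
  dsum (fun i : tridegree n => gsec A (tri_q i) (tri_k i) (tri_p i)).

Definition tot_ddif n (c : tot_cochains n) k p q :
    (k + p + q = n.+1)%N -> gsec A q k p :=
  if q is q'.+1 return (k + p + q = n.+1)%N -> gsec A q k p
  then fun e => ddif (c (Trideg (degr_pred e))) else fun _ => 0.

Definition tot_hdif n (c : tot_cochains n) k p q :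
    (k + p + q = n.+1)%N -> gsec A q k p :=
  if p is p'.+1 return (k + p + q = n.+1)%N -> gsec A q k p
  then fun e => hdif (c (Trideg (degm_pred e))) else fun _ => 0.

Definition tot_vdif n (c : tot_cochains n) k p q :
    (k + p + q = n.+1)%N -> gsec A q k p :=
  if k is k'.+1 return (k + p + q = n.+1)%N -> gsec A q k p
  then fun e => vdif (c (Trideg (degk_pred e))) else fun _ => 0.

Definition tot_d n (c : tot_cochains n) : tot_cochains n.+1 := fun i =>
  tot_ddif c (tri_eq i) *~ (-1) ^+ (tri_k i + tri_p i) +
  tot_hdif c (tri_eq i) *~ (-1) ^+ tri_k i + tot_vdif c (tri_eq i).

Lemma tot_d_is_zmod_morphism n : zmod_morphism (@tot_d n).
Proof.
move=> x y; apply: functional_extensionality_dep => -[k p q e].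
change (tot_d (x - y) (Trideg e) = tot_d x (Trideg e) - tot_d y (Trideg e)).
rewrite /tot_d /=.
have -> : tot_ddif (x - y) e = tot_ddif x e - tot_ddif y e.
  by case: q e => [|q] e /=; rewrite ?subrr // -raddfB.
have -> : tot_hdif (x - y) e = tot_hdif x e - tot_hdif y e.
  by case: p e => [|p] e /=; rewrite ?subrr // -raddfB.
have -> : tot_vdif (x - y) e = tot_vdif x e - tot_vdif y e.
  by case: k e => [|k] e /=; rewrite ?subrr // -raddfB.
by rewrite !mulrzBl !opprD [RHS]addrACA [X in _ = X + _]addrACA.
Qed.
HB.instance Definition _ n :=
  GRing.isZmodMorphism.Build _ _ (@tot_d n) (@tot_d_is_zmod_morphism n).

Lemma tot_d2 n (c : tot_cochains n) : tot_d (tot_d c) = 0.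
Proof.
apply: functional_extensionality_dep => -[k p q e].
change (tot_d (tot_d c) (Trideg e) = 0).
have irr k' p' q' (e1 e2 : (k' + p' + q' = n)%N) :
    c (Trideg e1) = c (Trideg e2) by rewrite (eq_irrelevance e1 e2).
have dd k' p' q' (e1 : (k' + p' + q' = n.+1)%N) : ddif (tot_ddif c e1) = 0.
  by case: q' e1 => [|q'] e1 /=; rewrite ?raddf0 ?ddif2.
have hh k' p' q' (e1 : (k' + p' + q' = n.+1)%N) : hdif (tot_hdif c e1) = 0.
  by case: p' e1 => [|p'] e1 /=; rewrite ?raddf0 ?hdif2.
have vv k' p' q' (e1 : (k' + p' + q' = n.+1)%N) : vdif (tot_vdif c e1) = 0.
  by case: k' e1 => [|k'] e1 /=; rewrite ?raddf0 ?vdif2.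
have cancel (V : zmodType) (a : V) (x y : int) :
    x = - y -> a *~ x + a *~ y = 0 by move=> ->; rewrite mulrNz addNr.
rewrite {1}/tot_d /=.
case: q e => [|q] e; case: p e => [|p] e; case: k e => [|k] e;
  rewrite /= /tot_d /= ?raddfD /= ?raddfMz /= ?dd ?hh ?vv /= ?raddf0
    ?mul0rz ?add0r ?addr0 ?mul0rz ?ddif_hdif ?ddif_vdif ?hdif_vdif //.
- rewrite (irr _ _ _ (degm_pred (degk_pred e)) (degk_pred (degm_pred e))).
  by apply: cancel; rewrite exprS mulN1r.
- rewrite (irr _ _ _ (degr_pred (degk_pred e)) (degk_pred (degr_pred e))).
  by apply: cancel; rewrite addSn exprS mulN1r.
- rewrite (irr _ _ _ (degr_pred (degm_pred e)) (degm_pred (degr_pred e))).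
  rewrite -!mulrzA.
  by apply: cancel; rewrite expr0 mul1r mulr1 !add0n exprS mulN1r.
rewrite (irr _ _ _ (degm_pred (degk_pred e)) (degk_pred (degm_pred e))).
rewrite (irr _ _ _ (degr_pred (degk_pred e)) (degk_pred (degr_pred e))).
rewrite (irr _ _ _ (degr_pred (degm_pred e)) (degm_pred (degr_pred e))).
rewrite !mulrzDl -!mulrzA [X in X + _ = _]addrACA cancel ?add0r; last first.
  by rewrite addnS (exprS _ (k.+1 + p)) mulN1r mulrN mulrC.
rewrite addrACA !cancel ?addr0 //; first by rewrite exprS mulN1r.
by rewrite addSn exprS mulN1r.
Qed.

Definition tot_complex : cochain_complex :=
  @CochainComplex tot_cochains (fun n => @tot_d n : {additive _ -> _}) tot_d2.
End Complexes.

(** ** Shuffles *)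

Definition shuffle k l (s : 'S_(k + l)) : bool :=
  [forall i : 'I_k, forall j : 'I_k,
     (i < j)%N ==> (s (lshift l i) < s (lshift l j))%N] &&
  [forall i : 'I_l, forall j : 'I_l,
     (i < j)%N ==> (s (rshift k i) < s (rshift k j))%N].

Section Shuffles.
Variables (k l : nat) (s : 'S_(k + l)).

(* b^s(i) and c^s(i); the condition s(j) < i replaces s(j) <= i because
   permutations act on {0, ..., k + l - 1}. *)
Definition shuffle_b_nat (i : nat) : nat :=
  #|[set j : 'I_k | (s (lshift l j) < i)%N]%SET|.
Definition shuffle_c_nat (i : nat) : nat :=
  #|[set j : 'I_l | (s (rshift k j) < i)%N]%SET|.

Lemma shuffle_b_lt i : (shuffle_b_nat i < k.+1)%N.
Proof. by rewrite ltnS -[X in (_ <= X)%N]card_ord max_card. Qed.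

Lemma shuffle_c_lt i : (shuffle_c_nat i < l.+1)%N.
Proof. by rewrite ltnS -[X in (_ <= X)%N]card_ord max_card. Qed.

Lemma shuffle_b_nd (i j : 'I_(k + l).+1) : (i <= j)%N ->
  (Ordinal (shuffle_b_lt i) <= Ordinal (shuffle_b_lt j))%N.
Proof.
move=> ij; apply/subset_leq_card/fintype.subsetP => x.
by rewrite !finset.inE => xi; exact: leq_trans ij.
Qed.

Lemma shuffle_c_nd (i j : 'I_(k + l).+1) : (i <= j)%N ->
  (Ordinal (shuffle_c_lt i) <= Ordinal (shuffle_c_lt j))%N.
Proof.
move=> ij; apply/subset_leq_card/fintype.subsetP => x.
by rewrite !finset.inE => xi; exact: leq_trans ij.
Qed.

Definition shuffle_hom : d2hom 0 (k + l) k l :=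
  @D2hom 0 (k + l) k l None (Some (mono_of shuffle_b_nd))
    (mono_of shuffle_c_nd) isT.
End Shuffles.

(* The (1, p)-shuffle s with s(1) = i + 1, for i = 0, ..., p. *)
Definition insert_perm p (i : 'I_p.+1) : 'S_(1 + p) := lift_perm ord0 i 1%g.

Lemma insert_perm0 p (i : 'I_p.+1) : insert_perm i ord0 = i.
Proof. by rewrite lift_perm_id. Qed.

Lemma insert_permS p (i : 'I_p.+1) (j : 'I_p) :
  insert_perm i (rshift 1 j) = lift i j.
Proof.
have -> : rshift 1 j = lift ord0 j by exact: val_inj.
by rewrite /insert_perm lift_perm_lift perm1.
Qed.

Lemma insert_perm_shuffle p (i : 'I_p.+1) : @shuffle 1 p (insert_perm i).
Proof.
apply/andP; split; apply/forallP => a; apply/forallP => b; apply/implyP.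
  by rewrite !ord1.
by rewrite !insert_permS /= => ab; rewrite ltnNge leq_bump2 -ltnNge.
Qed.

Definition transgression (G0 N1 G1 : topologicalType)
    (cm : crossed_module G0 N1 G1) (A : d2complex cm) q k l
    (a : gsec A q 0 (k + l)) : gsec A q k l :=
  \sum_(s : 'S_(k + l) | shuffle s)
    pullT A q (shuffle_hom s) a *~ (-1) ^+ odd_perm s.

Section Formulas.
Variables (G0 N1 G1 : topologicalType) (cm : crossed_module G0 N1 G1).

(* u_i in f~_s(x; g) = (u_1, ..., u_{k+l}), in terms of s^-1 *)
Definition shuffle_entry k l (s : 'S_(k + l)) (p : NG cm k l)
    (i : 'I_(k + l)) : G1 :=
  match fintype.split ((s^-1)%g i) with
  | inr m => gs p m
  | inl m =>
      phi cm (cm_act cm (xs p m) (gprod (cmG cm) (base p)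
        (pmap (fun j => if fintype.split ((s^-1)%g j) is inr r
                        then Some (gs p r) else None)
              [seq j : 'I_(k + l) <- enum 'I_(k + l) | (j < i)%N])))
  end.

(* The entries of (g_1, ..., g_i, phi(x)^(g_1...g_i), g_{i+1}, ..., g_p) *)
Definition insert_entry p (i : 'I_p.+1) (x : NG cm 1 p) (j : 'I_(1 + p)) : G1 :=
  if unlift i j is Some m then gs x m
  else gconj (cmG cm) (phi cm (xs x ord0)) (gsprod x ord0 i).
End Formulas.

Arguments transgression {G0 N1 G1 cm} A q k l a.
Arguments pullT {G0 N1 G1 cm} A q {k l k' l'} f.

(* Main.v *)
From HB Require Import structures.
Require Import Defs.
From mathcomp Require Import all_boot all_order all_algebra all_fingroup.
From mathcomp Require Import generic_quotient ring_quotient zify.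
From mathcomp Require Import all_classical topology.

(** A (k,l)-shuffle is a monotone lattice path from (0,0) to (k,l), and the
    morphism f_sigma is that path: its components b and c are the two
    coordinates of the points visited.  So T_k is the signed sum over the
    maximal chains of [k] x [l], the shuffle triangulation of a product of two
    simplices, and the chain map property says that the boundary of the
    triangulated product is the triangulation of the boundary: deleting a point
    of a path either deletes a level of [k] (a face of N_.), or a level of [l]
    (a face of the nerve of N_k x| Gamma), or gives a path that occurs twice
    with opposite signs, when the deleted point is a turn.

    Instead of an involution on turns, the proof is an induction on the last
    step.  A path to (k,l) is a path to (k,l-1) or to (k-1,l), followed by the
    point (k,l), so the signed sum S(k,l) satisfies
      S(k,l) = S(k,l-1).(k,l) + (-1)^l S(k-1,l).(k,l),
    and the boundary formula [shuffle_sum_of_faces] follows by applying the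
    induction hypothesis to both summands: the only turns left are those at the
    last step, and their two contributions are equal and opposite.  The sums
    are taken against an arbitrary function on lists of points, so that no
    dependent type occurs in the induction; on the side of permutations the
    recursion is the removal of the index sent to the maximum by
    [lift_perm], whose sign is known.

    [transgressionE] reads T_k as such a sum, which turns the boundary formula
    into [transgression_hdif], that is T_k partial = (-1)^k partial T_k +
    partial' T_{k-1}, and then into [total_transgression_d].  The degenerate
    pairs (a, b), in which each map is empty or constant, induce the same
    restriction for a given c; this gives T_0 = Id ([transgression0]), and also
    partial' T_0 = 0 ([vdif_row0]), since the two faces N_1 -> N_0 coincide.
    Hence T_1 anticommutes with the differentials and acts on cohomology.
    The formula for the entries of f~_sigma is a count of the steps of the path
    before its i-th step ([gs_tilde_shuffle]). *)

Set Implicit Arguments.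
Unset Strict Implicit.
Unset Printing Implicit Defensive.

Import Order.TTheory GRing.Theory.
Local Open Scope classical_set_scope.
Local Open Scope ring_scope.

(** * Shuffles as lattice paths *)

(** The shuffle condition on 'S_n with n unrelated to k: the length of the second
    block is n - k, so that recursion on n meets no sum in a type. *)
Definition block_increasing n k (s : 'S_n) : bool :=
  [forall i : 'I_n, forall j : 'I_n,
     [&& (i < j)%N & (j < k)%N || (k <= i)%N] ==> (s i < s j)%N].

Lemma block_increasingP n k (s : 'S_n) :
  reflect (forall i j : 'I_n, (i < j)%N -> (j < k)%N || (k <= i)%N ->
             (s i < s j)%N)
          (block_increasing k s).
Proof.
apply: (iffP forallP) => [inc i j ij kij | inc i].
  by apply: (implyP (forallP (inc i) j)); rewrite ij.
by apply/forallP => j; apply/implyP => /andP[ij kij]; exact: inc.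
Qed.

(** Position s j is the time of the j-th step; the first k steps move the first
    coordinate.  At time i the path is at (front_steps k s i, back_steps k s i). *)
Definition front_steps n k (s : 'S_n) i : nat :=
  \sum_(j < n) ((j < k)%N && (s j < i)%N).
Definition back_steps n k (s : 'S_n) i : nat :=
  \sum_(j < n) ((k <= j)%N && (s j < i)%N).

Definition lattice_path n k (s : 'S_n) : seq (nat * nat) :=
  mkseq (fun i => (front_steps k s i, back_steps k s i)) n.+1.

Lemma bump_lt i j k : (bump i j < k)%N = (j < k - (i < k))%N.
Proof. rewrite /bump; case: leqP; case: ltnP; lia. Qed.

Lemma bump_ge i j k : (k <= bump i j)%N = (k - (i < k) <= j)%N.
Proof. rewrite /bump; case: leqP; case: ltnP; lia. Qed.

Lemma bump_lt2 h i j : (bump h i < bump h j)%N = (i < j)%N.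
Proof. by rewrite ltnNge leq_bump2 -ltnNge. Qed.

(** The maximal value is taken at the last index of one of the two blocks, and
    what remains is a shuffle in which that block is shorter by one. *)
Lemma block_increasing_lift n k (i0 : 'I_n.+1) (s : 'S_n) :
  block_increasing k (lift_perm i0 ord_max s) =
  ((i0.+1 == k) || (i0 == n :> nat)) && block_increasing (k - (i0 < k)) s.
Proof.
apply/block_increasingP/andP => [inc | [last /block_increasingP inc] i j].
  split.
    apply: contraT; rewrite negb_or => /andP[i0k i0n].
    have i1n : (i0.+1 < n.+1)%N by have := ltn_ord i0; lia.
    have := inc i0 (Ordinal i1n) (ltnSn _); rewrite lift_perm_id /= => lt_max.
    have kP : (i0.+1 < k)%N || (k <= i0)%N by lia.
    by have := leq_trans (lt_max kP) (leq_ord _); rewrite ltnn.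
  apply/block_increasingP => i j ij kij.
  have := inc (lift i0 i) (lift i0 j).
  by rewrite !lift_perm_lift !lift_max /= bump_lt2 bump_lt bump_ge; exact.
case: (unliftP i0 j) => [j' ->|->]; case: (unliftP i0 i) => [i' ->|->].
- by rewrite !lift_perm_lift !lift_max /= bump_lt2 bump_lt bump_ge; exact: inc.
- rewrite /= => ij kij; exfalso; move: last kij.
  have := ltn_ord (lift i0 j'); rewrite /=; move: ij; rewrite /bump; lia.
- by rewrite lift_perm_id lift_perm_lift lift_max /= ltn_ord.
- by rewrite ltnn.
Qed.

Lemma front_steps_lift n k (i0 : 'I_n.+1) (s : 'S_n) i : (i <= n)%N ->
  front_steps k (lift_perm i0 ord_max s) i = front_steps (k - (i0 < k)) s i.
Proof.
move=> le_in; rewrite /front_steps (bigD1_ord i0) //= lift_perm_id /= (ltnNge n) le_in.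
rewrite andbF add0n; apply: eq_bigr => j _.
by rewrite lift_perm_lift lift_max bump_lt.
Qed.

Lemma back_steps_lift n k (i0 : 'I_n.+1) (s : 'S_n) i : (i <= n)%N ->
  back_steps k (lift_perm i0 ord_max s) i = back_steps (k - (i0 < k)) s i.
Proof.
move=> le_in; rewrite /back_steps (bigD1_ord i0) //= lift_perm_id /= (ltnNge n) le_in.
rewrite andbF add0n; apply: eq_bigr => j _.
by rewrite lift_perm_lift lift_max bump_ge.
Qed.

Lemma sum_nat_lt n k : (k <= n)%N -> (\sum_(j < n) (j < k) = k)%N.
Proof.
move=> kn; rewrite -(big_mkord xpredT (fun j => nat_of_bool (j < k)%N)).
rewrite (big_cat_nat (n := k)) //= [X in (_ + X)%N]big_nat [X in (_ + X)%N]big1.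
  rewrite addn0 big_nat -[RHS](subn0 k) -[RHS]muln1 -sum_nat_const_nat [RHS]big_nat.
  by apply: eq_bigr => j /= ->.
by move=> j /andP[kj _]; rewrite ltnNge kj.
Qed.

Lemma front_steps_end n k (s : 'S_n) : (k <= n)%N -> front_steps k s n = k.
Proof.
by move=> kn; rewrite -[RHS](sum_nat_lt kn); apply: eq_bigr => j _;
  rewrite ltn_ord andbT.
Qed.

Lemma front_back_steps n k (s : 'S_n) i : (i <= n)%N ->
  (front_steps k s i + back_steps k s i = i)%N.
Proof.
move=> le_in; rewrite -big_split /= -[RHS](sum_nat_lt le_in).
rewrite [RHS](reindex_inj (@perm_inj _ s)) /=; apply: eq_bigr => j _.
by case: (ltnP j k) => /=; rewrite ?addn0.
Qed.

Lemma front_steps_le n k (s : 'S_n) i : (k <= n)%N -> (front_steps k s i <= k)%N.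
Proof.
move=> kn; rewrite -[leqRHS](front_steps_end s kn); apply: leq_sum => j _.
by case: (j < k)%N; rewrite //= ltn_ord leq_b1.
Qed.

Lemma back_steps_le n k (s : 'S_n) i : (k <= n)%N ->
  (back_steps k s i <= n - k)%N.
Proof.
move=> kn; have := front_back_steps k s (leqnn n).
rewrite front_steps_end // => /(congr1 (fun m => m - k)%N).
rewrite addKn => <-; apply: leq_sum => j _.
by case: (k <= j)%N; rewrite //= ltn_ord leq_b1.
Qed.

(** The step made at the maximal time is the last step of the path, so removing it
    removes the last point. *)
Lemma lattice_path_lift n k (i0 : 'I_n.+1) (s : 'S_n) : (k <= n.+1)%N ->
  lattice_path k (lift_perm i0 ord_max s) =
  rcons (lattice_path (k - (i0 < k)) s) (k, n.+1 - k)%N.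
Proof.
move=> kn; rewrite /lattice_path mkseqS; congr rcons.
  by apply/eq_in_map => i; rewrite mem_iota => /andP[_ ik];
    rewrite front_steps_lift ?back_steps_lift.
have := front_back_steps k (lift_perm i0 ord_max s) (leqnn n.+1).
rewrite front_steps_end // => /(congr1 (fun m => m - k)%N).
by rewrite addKn => ->.
Qed.

Lemma lift_perm_inj n (i j : 'I_n.+1) : injective (lift_perm i j).
Proof.
move=> s t e; apply/permP => x; apply: (@lift_inj _ j).
by rewrite -!(lift_perm_lift i) e.
Qed.

(** With [lift_perm_inj]: the permutations sending i to j are parametrised by
    [lift_perm i j]. *)
Lemma lift_perm_surj n (i : 'I_n.+1) (s : 'S_n.+1) :
  exists t : 'S_n, s = lift_perm i (s i) t.
Proof.
pose f x := odflt x (unlift (s i) (s (lift i x))).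
have fE x : lift (s i) (f x) = s (lift i x).
  rewrite /f; case: unliftP => [y -> //|/perm_inj e].
  by case/eqP: (neq_lift i x).
have f_inj : injective f.
  by move=> x y e; apply/(@lift_inj _ i)/(@perm_inj _ s); rewrite -!fE e.
exists (perm f_inj); apply/permP => x.
case: (unliftP i x) => [y ->|->]; last by rewrite lift_perm_id.
by rewrite lift_perm_lift permE fE.
Qed.

(** * Signed sums over shuffles *)

Section ShuffleSum.
Variable V : zmodType.
Implicit Type F : seq (nat * nat) -> V.

(** The function [F] lives on untyped lists of points: it can then be composed with
    the addition, removal or renumbering of points without casts. *)
Definition shuffle_sum n k F : V :=
  \sum_(s : 'S_n | block_increasing k s) F (lattice_path k s) *~ (-1) ^+ s.

Lemma sum_lift_perm n (i0 j0 : 'I_n.+1) (P : pred 'S_n.+1) (H : 'S_n.+1 -> V) :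
  \sum_(s | P s && (s i0 == j0)) H s =
  \sum_(s : 'S_n | P (lift_perm i0 j0 s)) H (lift_perm i0 j0 s).
Proof.
transitivity
  (\sum_(s in imset (lift_perm i0 j0)
             (mem [pred t | P (lift_perm i0 j0 t)])) H s).
  apply: eq_bigl => s; apply/andP/imsetP => [[Ps /eqP si0]|[t Pt ->]].
    have [t st] := lift_perm_surj i0 s; exists t; rewrite ?inE /= -si0 -st //.
  by rewrite lift_perm_id eqxx.
by rewrite big_imset // => t t' _ _; exact: lift_perm_inj.
Qed.

(** The last step belongs to the first block (i.+1 = k) or to the second (i = n);
    removing it costs the sign of [odd_lift_perm]. *)
Lemma shuffle_sum_last n k F : (k <= n.+1)%N ->
  let F' s := F (rcons s (k, n.+1 - k)%N) in
  shuffle_sum n.+1 k F =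
  \sum_(i < n.+1 | (i.+1 == k) || (i == n :> nat))
     shuffle_sum n (k - (i < k)) F' *~ (-1) ^+ (i + n).
Proof.
move=> kn F'; rewrite /shuffle_sum.
rewrite (partition_big (fun s : 'S_n.+1 => (s^-1)%g ord_max) xpredT) //=.
rewrite [RHS]big_mkcond; apply: eq_bigr => i _.
transitivity (\sum_(s : 'S_n.+1 | block_increasing k s && (s i == ord_max))
   F (lattice_path k s) *~ (-1) ^+ s).
  apply: eq_bigl => s; congr (_ && _).
  by rewrite -(inj_eq (@perm_inj _ s)) permKV eq_sym.
rewrite sum_lift_perm; under eq_bigl do rewrite block_increasing_lift.
case: ifP => _ /=; last by rewrite big_pred0.
rewrite mulrz_suml; apply: eq_bigr => s _.
rewrite lattice_path_lift // -mulrzA; congr (_ *~ _).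
by rewrite odd_lift_perm !signr_addb !signr_odd exprD [RHS]mulrC.
Qed.

(** The paths have k + l + 1 points and stay in the rectangle [0,k] x [0,l], so
    only the values of [F] on such lists matter. *)
Lemma eq_shuffle_sum k l F F' :
  (forall s, size s = (k + l).+1 ->
     (forall p, p \in s -> (p.1 <= k)%N && (p.2 <= l)%N) -> F s = F' s) ->
  shuffle_sum (k + l) k F = shuffle_sum (k + l) k F'.
Proof.
move=> eqF; apply: eq_bigr => s _; congr (_ *~ _); apply: eqF.
  by rewrite size_mkseq.
move=> p /mapP[i]; rewrite mem_iota add0n ltnS => /andP[_ ikl] -> /=.
rewrite front_steps_le ?leq_addr //.
by rewrite (leq_trans (back_steps_le _ _ _)) ?addKn ?leq_addr.
Qed.

Lemma shuffle_sumD n k F F' :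
  shuffle_sum n k (fun s => F s + F' s) = shuffle_sum n k F + shuffle_sum n k F'.
Proof.
by rewrite /shuffle_sum -big_split /=; apply: eq_bigr => s _; rewrite mulrzDl.
Qed.

Lemma shuffle_sumMz n k F (z : int) :
  shuffle_sum n k (fun s => F s *~ z) = shuffle_sum n k F *~ z.
Proof.
rewrite /shuffle_sum mulrz_suml; apply: eq_bigr => s _.
by rewrite -!mulrzA mulrC.
Qed.

Lemma shuffle_sum00 F : shuffle_sum 0 0 F = F [:: (0, 0)%N].
Proof.
have uniq_perm (s : 'S_0) : s = 1%g by apply/permP => -[].
rewrite /shuffle_sum (big_pred1 1%g) => [|s]; last first.
  by rewrite (uniq_perm s) /= eqxx; apply/block_increasingP => -[].
by rewrite odd_perm1 /lattice_path /mkseq /= /front_steps /back_steps !big_ord0.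
Qed.

Lemma shuffle_sumS0 k F :
  shuffle_sum (k.+1 + 0) k.+1 F =
  shuffle_sum (k + 0) k (fun s => F (rcons s (k.+1, 0)%N)).
Proof.
rewrite addSn shuffle_sum_last ?addn0 // (big_pred1 ord_max) => [|i].
  by rewrite subnn ltnSn subn1 addnn -signr_odd odd_double.
by rewrite eqSS orbb.
Qed.

Lemma shuffle_sum0S l F :
  shuffle_sum (0 + l.+1) 0 F =
  shuffle_sum (0 + l) 0 (fun s => F (rcons s (0, l.+1)%N)).
Proof.
rewrite !add0n shuffle_sum_last // (big_pred1 ord_max) => [|i] //.
by rewrite !subn0 addnn -signr_odd odd_double.
Qed.

(** A front step in last position jumps over the l.+1 back steps, whence the
    sign. *)
Lemma shuffle_sumSS k l F :
  let F' s := F (rcons s (k.+1, l.+1)%N) in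
  shuffle_sum (k.+1 + l.+1) k.+1 F =
  shuffle_sum (k.+1 + l) k.+1 F' + shuffle_sum (k + l.+1) k F' *~ (-1) ^+ l.+1.
Proof.
move=> F'; rewrite addSn shuffle_sum_last ?ltnS ?leq_addr //.
rewrite subSS addKn [(k.+1 + l)%N]addSnnS.
have [n def_n] : exists n, n = (k + l.+1)%N by exists (k + l.+1)%N.
rewrite -def_n; have kn : (k < n)%N by rewrite def_n -addSnnS leq_addr.
rewrite (bigD1 ord_max) ?eqxx ?orbT //=.
rewrite (big_pred1 (widen_ord (leqnSn n) (Ordinal kn))).
  rewrite /= ltnSn subn1 ltnNge kn subn0 addnn -signr_odd odd_double mulr1z.
  congr (_ + _ *~ _).
  by rewrite -signr_odd def_n addnA oddD addnn odd_double signr_odd.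
move=> i; rewrite /= -!val_eqE /= eqSS.
by case: eqP => [->|_] //=; rewrite ?(ltn_eqF kn) ?andbN.
Qed.
End ShuffleSum.

(** * The boundary of the sum of all paths *)

Definition del_nth T i (s : seq T) := take i s ++ drop i.+1 s.

Lemma del_nth_rcons T i (s : seq T) v : (i < size s)%N ->
  del_nth i (rcons s v) = rcons (del_nth i s) v.
Proof.
move=> lt_is; rewrite /del_nth -!cats1 takel_cat ?(ltnW lt_is) // drop_cat.
case: ltnP => si; first by rewrite catA.
have /eqP-> : (i.+1 - size s == 0)%N by rewrite subn_eq0.
by rewrite (drop_oversize si) drop0 cats0.
Qed.

Lemma del_nth_rcons_last T (s : seq T) v : del_nth (size s) (rcons s v) = s.
Proof.
rewrite /del_nth -cats1 take_size_cat // drop_oversize ?cats0 //.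
by rewrite size_cat addn1.
Qed.

Lemma nth_del_nth T (x : T) s i j : nth x (del_nth i s) j = nth x s (bump i j).
Proof.
rewrite /del_nth nth_cat size_take /bump nth_drop.
case: (ltnP i (size s)) => [lt_is|si].
  by case: (ltnP j i) => ji; [rewrite nth_take|rewrite addSn subnKC].
rewrite take_oversize //; case: ltnP => [js|sj].
  by rewrite leqNgt (leq_trans js si).
by rewrite !nth_default //; lia.
Qed.

Lemma size_del_nth T i (s : seq T) : (i < size s)%N -> size (del_nth i s) = (size s).-1.
Proof. by move=> ?; rewrite size_cat size_take size_drop; case: ltnP; lia. Qed.

(** The maps of lattice points induced by the cofaces of [k] and of [l]. *)
Definition skip_front j (p : nat * nat) := (bump j p.1, p.2).
Definition skip_back j (p : nat * nat) := (p.1, bump j p.2).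

Section FaceSum.
Variable V : zmodType.
Implicit Type F : seq (nat * nat) -> V.

Definition face_sum F s : V := \sum_(i < size s) F (del_nth i s) *~ (-1) ^+ i.

Lemma face_sum_rcons F s v :
  face_sum F (rcons s v) =
  face_sum (fun s => F (rcons s v)) s + F s *~ (-1) ^+ size s.
Proof.
rewrite /face_sum size_rcons big_ord_recr /= del_nth_rcons_last; congr (_ + _).
by apply: eq_bigr => i _; rewrite del_nth_rcons.
Qed.

Definition front_faces k l F : V :=
  if k is k'.+1 then
    \sum_(j < k'.+2)
      shuffle_sum (k' + l) k' (fun s => F (map (skip_front j) s)) *~ (-1) ^+ j
  else 0.

Definition back_faces k l F : V :=
  if l is l'.+1 then
    \sum_(j < l'.+2)
      shuffle_sum (k + l') k (fun s => F (map (skip_back j) s)) *~ (-1) ^+ j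
  else 0.

(** Deleting the only point of the path from (0,0) to (0,0) leaves the empty list,
    which comes from neither factor.  With this term the induction starts at
    k = l = 0: for F' s = F (rcons s v) it is the value of [F] at [:: v], a genuine
    face of the path from (0,0) to v. *)
Definition end_term k l F : V := if (k + l == 0)%N then F [::] else 0.

(** Used for the last cofaces, which fix every point of the smaller rectangle. *)
Lemma shuffle_sum_map_id k l F f :
  (forall p, (p.1 <= k)%N -> (p.2 <= l)%N -> f p = p) ->
  shuffle_sum (k + l) k (fun s => F (map f s)) = shuffle_sum (k + l) k F.
Proof.
move=> fE; apply: eq_shuffle_sum => s _ sP; congr F; rewrite -[RHS]map_id.
by apply/eq_in_map => p /sP/andP[]; exact: fE.
Qed.

Lemma mulrz_signS (x : V) n : x *~ (-1) ^+ n.+1 = - (x *~ (-1) ^+ n).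
Proof. by rewrite exprS mulN1r mulrNz. Qed.

(** The last coface of [k] acts trivially on the paths to (k,l), so the last summand
    of [front_faces] is the plain sum over these paths. *)
Lemma front_faces_but_last k l F :
  front_faces k.+1 l F + shuffle_sum (k + l) k F *~ (-1) ^+ k =
  \sum_(j < k.+1)
    shuffle_sum (k + l) k (fun s => F (map (skip_front j) s)) *~ (-1) ^+ j.
Proof.
rewrite /front_faces big_ord_recr /= shuffle_sum_map_id => [|[a b] /= ak _].
  by rewrite exprS mulN1r mulrNz addrNK.
by rewrite /skip_front /bump /= ltnNge ak.
Qed.

Lemma back_faces_but_last k l F :
  back_faces k l.+1 F + shuffle_sum (k + l) k F *~ (-1) ^+ l =
  \sum_(j < l.+1)
    shuffle_sum (k + l) k (fun s => F (map (skip_back j) s)) *~ (-1) ^+ j.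
Proof.
rewrite /back_faces big_ord_recr /= shuffle_sum_map_id => [|[a b] /= _ bl].
  by rewrite exprS mulN1r mulrNz addrNK.
by rewrite /skip_back /bump /= ltnNge bl.
Qed.

(** For j <= k the coface moves the end point (k,l.+1) to (k.+1,l.+1); removing it by
    the recursion gives front faces of F'.  The term [shuffle_sum (k + l) k F']
    compensates the summand j = k.+1 of [front_faces k.+1 l F']; these
    are the paths whose last turn, just before the end point, has been deleted, and
    they cancel in [shuffle_sum_of_faces] against the same term of [back_facesSS]. *)
Lemma front_facesSS k l F : let F' s := F (rcons s (k.+1, l.+1)%N) in
  front_faces k.+1 l.+1 F =
  front_faces k.+1 l F' + shuffle_sum (k + l) k F' *~ (-1) ^+ k +
  front_faces k l.+1 F' *~ (-1) ^+ l.+1 +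
  shuffle_sum (k + l.+1) k F *~ (-1) ^+ k.+1.
Proof.
move=> F'; rewrite -[LHS](addrK (shuffle_sum (k + l.+1) k F *~ (-1) ^+ k)).
rewrite front_faces_but_last (mulrz_signS _ k); congr (_ + _).
rewrite front_faces_but_last; case: k @F' => [|k] F'.
  rewrite /= mul0rz addr0 !big_ord1; congr (_ *~ _).
  rewrite shuffle_sum0S; apply: eq_bigr => s _.
  by rewrite map_rcons.
rewrite mulrz_suml -big_split /=; apply: eq_bigr => j _.
have jk : (j <= k.+1)%N by rewrite -ltnS.
have skipE s : F (map (skip_front j) (rcons s (k.+1, l.+1))) =
    F' (map (skip_front j) s).
  by rewrite map_rcons /skip_front /bump /= jk.
rewrite shuffle_sumSS mulrzDl; congr (_ *~ _ + _).
  by apply: eq_bigr => s _; rewrite skipE.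
rewrite -!mulrzA mulrC; congr (_ *~ _).
by apply: eq_bigr => s _; rewrite skipE.
Qed.

Lemma front_facesS0 k F : let F' s := F (rcons s (k.+1, 0)%N) in
  front_faces k.+1 0 F =
  front_faces k 0 F' + end_term k 0 F' +
  shuffle_sum (k + 0) k F *~ (-1) ^+ k.+1.
Proof.
move=> F'; rewrite -[LHS](addrK (shuffle_sum (k + 0) k F *~ (-1) ^+ k)).
rewrite front_faces_but_last (mulrz_signS _ k); congr (_ + _).
case: k @F' => [|k] F'; first by rewrite big_ord1 shuffle_sum00 /= add0r.
rewrite /end_term /= addr0; apply: eq_bigr => j _.
have jk : (j <= k.+1)%N by rewrite -ltnS.
rewrite shuffle_sumS0; congr (_ *~ _); apply: eq_bigr => s _.
by rewrite map_rcons /skip_front /bump /= jk.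
Qed.

Lemma back_facesSS k l F : let F' s := F (rcons s (k.+1, l.+1)%N) in
  back_faces k.+1 l.+1 F =
  back_faces k.+1 l F' + shuffle_sum (k + l) k F' +
  back_faces k l.+1 F' *~ (-1) ^+ l +
  shuffle_sum (k.+1 + l) k.+1 F *~ (-1) ^+ l.+1.
Proof.
move=> F'; rewrite -[LHS](addrK (shuffle_sum (k.+1 + l) k.+1 F *~ (-1) ^+ l)).
rewrite back_faces_but_last (mulrz_signS _ l); congr (_ + _).
have -> : back_faces k.+1 l F' + shuffle_sum (k + l) k F' +
    back_faces k l.+1 F' *~ (-1) ^+ l =
    back_faces k.+1 l F' +
    (back_faces k l.+1 F' + shuffle_sum (k + l) k F' *~ (-1) ^+ l) *~ (-1) ^+ l.
  rewrite mulrzDl -mulrzA -exprD addnn -[(-1) ^+ l.*2]signr_odd odd_double mulr1z.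
  by rewrite -addrA (addrC (shuffle_sum _ _ _)).
rewrite back_faces_but_last; case: l @F' => [|l] F'.
  rewrite /= add0r !big_ord1 shuffle_sumS0 expr0 !mulr1z.
  by apply: eq_bigr => s _; rewrite map_rcons.
rewrite mulrz_suml -big_split /=; apply: eq_bigr => j _.
have jl : (j <= l.+1)%N by rewrite -ltnS.
have skipE s : F (map (skip_back j) (rcons s (k.+1, l.+1))) =
    F' (map (skip_back j) s).
  by rewrite map_rcons /skip_back /bump /= jl.
rewrite shuffle_sumSS mulrzDl; congr (_ *~ _ + _).
  by apply: eq_bigr => s _; rewrite skipE.
rewrite -!mulrzA mulrC; congr (_ *~ _).
by apply: eq_bigr => s _; rewrite skipE.
Qed.

Lemma back_faces0S l F : let F' s := F (rcons s (0, l.+1)%N) in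
  back_faces 0 l.+1 F =
  back_faces 0 l F' + end_term 0 l F' + shuffle_sum (0 + l) 0 F *~ (-1) ^+ l.+1.
Proof.
move=> F'; rewrite -[LHS](addrK (shuffle_sum (0 + l) 0 F *~ (-1) ^+ l)).
rewrite back_faces_but_last (mulrz_signS _ l); congr (_ + _).
case: l @F' => [|l] F'; first by rewrite big_ord1 shuffle_sum00 /= add0r.
rewrite /end_term /= addr0; apply: eq_bigr => j _.
have jl : (j <= l.+1)%N by rewrite -ltnS.
rewrite shuffle_sum0S; congr (_ *~ _); apply: eq_bigr => s _.
by rewrite map_rcons /skip_back /bump /= jl.
Qed.

Lemma shuffle_sum_face_sum_rcons k l v F :
  shuffle_sum (k + l) k (fun s => face_sum F (rcons s v)) =
  shuffle_sum (k + l) k (face_sum (fun s => F (rcons s v))) +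
  shuffle_sum (k + l) k F *~ (-1) ^+ (k + l).+1.
Proof.
rewrite -shuffle_sumMz -shuffle_sumD; apply: eq_shuffle_sum => s sz _.
by rewrite face_sum_rcons sz.
Qed.

Lemma eq_sign m n : odd m = odd n -> (-1) ^+ m = (-1) ^+ n :> int.
Proof. by move=> e; rewrite -signr_odd e signr_odd. Qed.

(** The boundary formula: all faces at a turn cancel, and the others are faces of
    one of the two factors. *)
Lemma shuffle_sum_of_faces k l F :
  shuffle_sum (k + l) k (face_sum F) =
  front_faces k l F + back_faces k l F *~ (-1) ^+ k + end_term k l F.
Proof.
elim: k l F => [|k IHk]; elim=> [|l IHl] F.
- by rewrite shuffle_sum00 /face_sum big_ord1 /= mul0rz !add0r.
- rewrite shuffle_sum0S shuffle_sum_face_sum_rcons IHl back_faces0S /end_term /=.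
  by rewrite !add0r !addr0 !mulr1z !add0n.
- rewrite shuffle_sumS0 shuffle_sum_face_sum_rcons IHk front_facesS0 /end_term /=.
  by rewrite !mul0rz !addr0 !addn0.
have end_term0S m F' : end_term m l.+1 F' = 0 by rewrite /end_term addnS.
have end_termS0 m F' : end_term k.+1 m F' = 0 by [].
rewrite shuffle_sumSS !shuffle_sum_face_sum_rcons IHl IHk front_facesSS back_facesSS.
rewrite !end_termS0 !end_term0S !addr0 !mulrzDl -!mulrzA -!exprD.
have -> : (-1) ^+ ((k + l.+1).+1 + l.+1) = (-1) ^+ k.+1 :> int.
  by apply: eq_sign; lia.
have -> : (-1) ^+ (k.+1 + l).+1 = (-1) ^+ (l.+1 + k.+1) :> int.
  by apply: eq_sign; lia.
have -> : (-1) ^+ (k + l.+1) = (-1) ^+ (l + k.+1) :> int.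
  by apply: eq_sign; lia.
rewrite (mulrz_signS (shuffle_sum (k + l) k _) k).
set v1 := front_faces k.+1 l _; set v2 := front_faces k l.+1 _ *~ _.
set h1 := back_faces k.+1 l _ *~ _; set h2 := back_faces k l.+1 _ *~ _.
(* the terms 2 and 6, from the deleted last turn, cancel *)
by rewrite [RHS](AC (4*4) (1*5*8*(3*7*4)*(2*6))) /= subrr addr0.
Qed.
End FaceSum.

(** * From shuffles to morphisms of Delta_2 *)

Lemma shuffle_block_increasing k l (s : 'S_(k + l)) :
  shuffle s = block_increasing k s.
Proof.
apply/andP/block_increasingP => [[incl incr] i j | inc]; last first.
  split; apply/forallP => i; apply/forallP => j; apply/implyP => ij.
    by apply: inc => //=; rewrite ltn_ord.
  by apply: inc; rewrite /= ?ltn_add2l ?leq_addr ?orbT.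
case: (split_ordP j) => j' ->; case: (split_ordP i) => i' -> /=.
- by move=> ij _; exact: (implyP (forallP (forallP incl i') j')).
- by move=> ij; have := ltn_ord j'; lia.
- by move=> _; have := ltn_ord i'; lia.
by rewrite ltn_add2l => ij _; exact: (implyP (forallP (forallP incr i') j')).
Qed.

Lemma shuffle_b_natE k l (s : 'S_(k + l)) i :
  shuffle_b_nat s i = front_steps k s i.
Proof.
rewrite /shuffle_b_nat -sum1dep_card big_mkcond /front_steps big_split_ord /=.
rewrite [X in (_ = _ + X)%N]big1 ?addn0 => [|j _]; last by rewrite ltnNge leq_addr.
by apply: eq_bigr => j _; rewrite ltn_ord /=; case: ifP.
Qed.

Lemma shuffle_c_natE k l (s : 'S_(k + l)) i :
  shuffle_c_nat s i = back_steps k s i.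
Proof.
rewrite /shuffle_c_nat -sum1dep_card big_mkcond /back_steps big_split_ord /=.
rewrite [X in (_ = X + _)%N]big1 ?add0n => [|j _]; last by rewrite leqNgt ltn_ord.
by apply: eq_bigr => j _; rewrite leq_addr /=; case: ifP.
Qed.

Section PathPoints.
Variables m k l : nat.
Implicit Types (b : mono m k) (c : mono m l).

(** The list of points determines the morphism (empty, b, c), and turns its
    composition with cofaces into the list operations of the boundary formula. *)
Definition path_points b c : seq (nat * nat) :=
  [seq (nat_of_ord (b i), nat_of_ord (c i)) | i <- enum 'I_m.+1].

Lemma size_path_points b c : size (path_points b c) = m.+1.
Proof. by rewrite size_map size_enum_ord. Qed.

Lemma nth_path_points b c (i : 'I_m.+1) x :
  nth x (path_points b c) i = (nat_of_ord (b i), nat_of_ord (c i)).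
Proof. by rewrite (nth_map i) ?size_enum_ord // nth_ord_enum. Qed.

Lemma path_points_inj b c b' c' :
  path_points b c = path_points b' c' -> b = b' /\ c = c'.
Proof.
move=> e; have {}e i : (b i, c i) = (b' i, c' i).
  have := congr1 (fun s => nth (0, 0)%N s i) e; rewrite !nth_path_points.
  by case=> eb ec; congr pair; apply: val_inj.
by split; apply/val_inj/ffunP => i; case: (e i).
Qed.

(** As a morphism is determined by its points, a function of morphisms extends by 0
    to all lists of points. *)
Lemma path_points_factor (V : zmodType) (Phi : mono m k -> mono m l -> V) :
  exists F : seq (nat * nat) -> V, forall b c, F (path_points b c) = Phi b c.
Proof.
exists (fun s => if pselect (exists bc, s = path_points bc.1 bc.2) is left h
                 then Phi (sval (cid h)).1 (sval (cid h)).2 else 0) => b c.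
case: pselect => [h|[]]; last by exists (b, c).
by case: (cid h) => -[b' c'] /= /path_points_inj[-> ->].
Qed.

Definition path_hom b c : d2hom 0 m k l :=
  @D2hom 0 m k l None (Some b) c isT.
End PathPoints.

Lemma path_points_face m k l (b : mono m.+1 k) (c : mono m.+1 l) (i : 'I_m.+2) :
  path_points (mono_comp b (mono_face i)) (mono_comp c (mono_face i)) =
  del_nth i (path_points b c).
Proof.
apply: (@eq_from_nth _ (0, 0)%N) => [|j].
  by rewrite size_del_nth !size_path_points.
rewrite size_path_points => jm; rewrite nth_del_nth.
rewrite (nth_path_points _ _ (Ordinal jm)) (nth_path_points _ _ (lift i (Ordinal jm))).
by rewrite !ffunE /= !ffunE.
Qed.

Lemma path_points_skip_front m k l (b : mono m k) (c : mono m l) (j : 'I_k.+2) :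
  path_points (mono_comp (mono_face j) b) c = map (skip_front j) (path_points b c).
Proof.
by rewrite /path_points -map_comp; apply: eq_map => i; rewrite /= !ffunE /= ?ffunE.
Qed.

Lemma path_points_skip_back m k l (b : mono m k) (c : mono m l) (j : 'I_l.+2) :
  path_points b (mono_comp (mono_face j) c) = map (skip_back j) (path_points b c).
Proof.
by rewrite /path_points -map_comp; apply: eq_map => i; rewrite /= !ffunE /= ?ffunE.
Qed.

Lemma path_points_shuffle k l (s : 'S_(k + l)) :
  path_points (mono_of (@shuffle_b_nd k l s)) (mono_of (@shuffle_c_nd k l s)) =
  lattice_path k s.
Proof.
rewrite /lattice_path /mkseq -val_enum_ord -map_comp; apply: eq_map => i /=.
by rewrite !ffunE /= shuffle_b_natE shuffle_c_natE.
Qed.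

(** * The total transgression is a chain map *)

Section ChainMap.
Variables (G0 N1 G1 : topologicalType) (cm : crossed_module G0 N1 G1).
Variable A : d2complex cm.

(** The component of bidegree (p, q) of [c] is used with p = k + l only up to a
    propositional equality; taking the component of a whole cochain absorbs this
    equality.  [Psi] will be the identity or a face map. *)
Lemma transgressionE q k l n (c : row_cochains A 0 n) p (V : zmodType)
    (e : (p + q = n)%N) (e' : (k + l + q = n)%N) (kl : (k + l = p)%N)
    (Psi : {additive gsec A q k l -> V}) (F : seq (nat * nat) -> V) :
  (forall b c0, F (path_points b c0) =
     Psi (pullT A q (path_hom b c0) (c (Bideg e)))) ->
  Psi (transgression A q k l (c (Bideg e'))) = shuffle_sum (k + l) k F.
Proof.
case: p / kl e => e; rewrite (eq_irrelevance e e') => FE.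
rewrite /transgression raddf_sum /=.
under eq_bigl do rewrite shuffle_block_increasing.
by apply: eq_bigr => s _; rewrite raddfMz -path_points_shuffle FE.
Qed.

Lemma transgression_is_zmod_morphism q k l :
  zmod_morphism (@transgression _ _ _ _ A q k l).
Proof.
move=> x y; rewrite /transgression -sumrB; apply: eq_bigr => s _.
by rewrite raddfB mulrzBl.
Qed.
HB.instance Definition _ q k l :=
  GRing.isZmodMorphism.Build _ _ (@transgression _ _ _ _ A q k l)
    (@transgression_is_zmod_morphism q k l).

Definition total_transgression n (c : row_cochains A 0 n) : tot_cochains A n :=
  fun i => transgression A (tri_q i) (tri_k i) (tri_p i) (c (Bideg (tri_eq i))).

Lemma total_transgression_is_zmod_morphism n :
  zmod_morphism (@total_transgression n).
Proof.
move=> x y; apply: functional_extensionality_dep => i.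
exact: (raddfB (transgression A (tri_q i) (tri_k i) (tri_p i))).
Qed.
HB.instance Definition _ n :=
  GRing.isZmodMorphism.Build _ _ (@total_transgression n)
    (@total_transgression_is_zmod_morphism n).

(** Precomposing a path with the i-th coface of [m] deletes its i-th point, while
    postcomposing it with a coface of [k] or [l] renumbers its points: these are
    the two sides of the boundary formula. *)
Lemma face_sum_pullT q k l m (a : gsec A q 0 m)
    (F : seq (nat * nat) -> gsec A q k l)
    (b : mono m.+1 k) (c : mono m.+1 l) :
  (forall b c, F (path_points b c) = pullT A q (path_hom b c) a) ->
  face_sum F (path_points b c) = pullT A q (path_hom b c) (hdif a).
Proof.
move=> FE; rewrite /face_sum /hdif raddf_sum size_path_points; apply: eq_bigr => i _.
rewrite raddfMz /= pullT_comp -path_points_face FE; congr (pullT A q _ a *~ _).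
exact: d2hom_eq.
Qed.

Lemma pullT_vface_path q k l m (a : gsec A q 0 m) (j : 'I_k.+2)
    (b : mono m k) (c : mono m l) :
  pullT A q (vface l j) (pullT A q (path_hom b c) a) =
  pullT A q (path_hom (mono_comp (mono_face j) b) c) a.
Proof.
rewrite pullT_comp; congr (pullT A q _ a).
by apply: d2hom_eq; rewrite //= mono_comp1.
Qed.

Lemma pullT_hface_path q k l m (a : gsec A q 0 m) (j : 'I_l.+2)
    (b : mono m k) (c : mono m l) :
  pullT A q (hface k j) (pullT A q (path_hom b c) a) =
  pullT A q (path_hom b (mono_comp (mono_face j) c)) a.
Proof.
rewrite pullT_comp; congr (pullT A q _ a).
by apply: d2hom_eq; rewrite //= mono_comp1.
Qed.

(** The boundary formula [shuffle_sum_of_faces] for the function that extends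
    (b, c) |-> (empty, b, c)^*; when k + l = 0 there is nothing to differentiate
    and both sides vanish. *)
Lemma transgression_hdif n (c : row_cochains A 0 n) k l q
    (e : (k + l + q = n.+1)%N) :
  transgression A q k l (row_hdif c e) =
  tot_hdif (total_transgression c) e *~ (-1) ^+ k +
  tot_vdif (total_transgression c) e.
Proof.
case: (posnP (k + l)) => [/eqP|kl_gt0].
  rewrite addn_eq0 => /andP[/eqP k0 /eqP l0]; move: e; rewrite k0 l0 => e.
  by rewrite /= raddf0 mul0rz addr0.
have [p klp] : exists p, (k + l = p.+1)%N by exists (k + l).-1; rewrite prednK.
have e1 : (p + q = n)%N by move: e; rewrite klp => -[].
have e2 : (p.+1 + q = n.+1)%N by rewrite addSn e1.
pose c' : row_cochains A 0 n.+1 := fun i => row_hdif c (bi_eq i).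
pose a := c (Bideg e1).
have [F FE] := path_points_factor (fun b c0 => pullT A q (@path_hom p k l b c0) a).
rewrite -[LHS]/(idfun (transgression A q k l (c' (Bideg e)))).
rewrite (transgressionE (e := e2) _ klp (F := face_sum F)) => [|b c0]; last first.
  by rewrite (face_sum_pullT _ _ FE) /a (eq_irrelevance e1 (degl_pred e2)).
rewrite shuffle_sum_of_faces /end_term klp addr0 addrC; congr (_ *~ _ + _).
  clear c'; case: l e klp {kl_gt0} F FE => [//|l] e klp F FE.
  have klp' : (k + l = p)%N by move: klp; rewrite addnS => -[].
  rewrite /= /hdif; apply: eq_bigr => j _; congr (_ *~ _).
  rewrite (transgressionE (e := e1) _ klp' (Psi := pullT A q (hface k j))
    (F := fun s => F (map (skip_back j) s))) //.
  by move=> b c0; rewrite -path_points_skip_back FE pullT_hface_path.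
clear c'; case: k e klp {kl_gt0} F FE => [//|k] e klp F FE.
have klp' : (k + l = p)%N by move: klp; rewrite addSn => -[].
rewrite /= /vdif; apply: eq_bigr => j _; congr (_ *~ _).
rewrite (transgressionE (e := e1) _ klp' (Psi := pullT A q (vface l j))
  (F := fun s => F (map (skip_front j) s))) //.
by move=> b c0; rewrite -path_points_skip_front FE pullT_vface_path.
Qed.

Lemma ddif_transgression q k l (a : gsec A q 0 (k + l)) :
  ddif (transgression A q k l a) = transgression A q.+1 k l (ddif a).
Proof.
rewrite /transgression raddf_sum; apply: eq_bigr => s _.
by rewrite raddfMz /= ddif_pullT.
Qed.

Lemma transgression_ddif n (c : row_cochains A 0 n) k l q
    (e : (k + l + q = n.+1)%N) :
  transgression A q k l (row_ddif c e) = tot_ddif (total_transgression c) e.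
Proof.
case: q e => [|q] e /=; first by rewrite raddf0.
by rewrite -ddif_transgression.
Qed.

Lemma total_transgression_d n (c : row_cochains A 0 n) :
  total_transgression (row_d c) = tot_d (total_transgression c).
Proof.
apply: functional_extensionality_dep => -[k l q e].
rewrite /total_transgression /tot_d /row_d /= raddfD raddfMz /=.
by rewrite transgression_hdif transgression_ddif addrA.
Qed.

(** With an empty first block every step is a back step. *)
Lemma back_steps0 n (s : 'S_n) i : (i <= n)%N -> back_steps 0 s i = i.
Proof.
move=> le_in; rewrite -[RHS](front_back_steps 0 s le_in).
by rewrite /front_steps big1.
Qed.

Lemma block_increasing0 n (s : 'S_n) : block_increasing 0 s = (s == 1%g).
Proof.
apply/block_increasingP/eqP => [inc | -> i j ij _]; last by rewrite !perm1.
apply/permP => i; rewrite perm1; apply: val_inj => /=.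
rewrite -[LHS](back_steps0 s) ?(ltnW (ltn_ord _)) //.
rewrite -[RHS](sum_nat_lt (ltnW (ltn_ord i))); apply: eq_bigr => j _ /=.
congr nat_of_bool; apply/idP/idP => [sij|]; last by move=> ji; exact: inc.
case: (ltngtP i j) => // [ij|/val_inj ij]; last by rewrite ij ltnn in sij.
by have := ltn_trans sij (inc _ _ ij _); rewrite ltnn orbT => /(_ isT).
Qed.

Lemma pullT_id q k l (a : gsec A q k l) : pullT A q (d2id k l) a = a.
Proof.
have sTT : opens_top (NG cm k l) `<=` opens_top (NG cm k l) by [].
by rewrite /pullT (pull_id _ sTT) rst_id.
Qed.

(** The only (0,l)-shuffle is the identity; its morphism (empty, b, Id) has a
    constant b, since [0] is a point, so it restricts like the identity
    (Id, empty, Id). *)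
Lemma transgression0 l q (a : gsec A q 0 l) : transgression A q 0 l a = a.
Proof.
rewrite /transgression (big_pred1 1%g) => [|s]; last first.
  by rewrite shuffle_block_increasing block_increasing0.
rewrite odd_perm1 mulr1z -[RHS]pullT_id; apply: pull_const => //=.
- by apply/forallP => i; apply/eqP/val_inj; rewrite !ord1.
- by apply/forallP => i; apply/eqP/val_inj; rewrite !ord1.
apply/val_inj/ffunP => i; apply: val_inj; rewrite !ffunE /= shuffle_c_natE.
by rewrite back_steps0 // -ltnS.
Qed.

(** Both cofaces [0] -> [1] are constant, so they restrict alike and their
    difference vanishes. *)
Lemma vdif_row0 l q (a : gsec A q 0 l) : vdif a = 0.
Proof.
rewrite /vdif big_ord_recl big_ord1 /= mulr1z mulrN1z.
apply/eqP; rewrite subr_eq0; apply/eqP; apply: pull_const => //=;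
by apply/forallP => i; rewrite !ord1.
Qed.

End ChainMap.

(** * The maps of spaces *)

Lemma front_stepsS n k (s : 'S_n) (i : 'I_n) :
  front_steps k s i.+1 = (front_steps k s i + ((s^-1)%g i < k))%N.
Proof.
rewrite /front_steps (bigD1 ((s^-1)%g i)) //= permKV ltnSn andbT addnC.
rewrite [in RHS](bigD1 ((s^-1)%g i)) //= permKV ltnn andbF add0n; congr (_ + _)%N.
apply: eq_bigr => j ji; rewrite ltnS [(s j <= i)%N]leq_eqVlt; case: eqP => // sji.
by case/eqP: ji; rewrite -(val_inj sji) permK.
Qed.

Lemma back_stepsS n k (s : 'S_n) (i : 'I_n) :
  back_steps k s i.+1 = (back_steps k s i + (k <= (s^-1)%g i))%N.
Proof.
rewrite /back_steps (bigD1 ((s^-1)%g i)) //= permKV ltnSn andbT addnC.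
rewrite [in RHS](bigD1 ((s^-1)%g i)) //= permKV ltnn andbF add0n; congr (_ + _)%N.
apply: eq_bigr => j ji; rewrite ltnS [(s j <= i)%N]leq_eqVlt; case: eqP => // sji.
by case/eqP: ji; rewrite -(val_inj sji) permK.
Qed.

Lemma shuffle_b_lshift k l (s : 'S_(k + l)) (m : 'I_k) : shuffle s ->
  shuffle_b_nat s (s (lshift l m)) = m.
Proof.
move=> /andP[/forallP inc _]; rewrite -[RHS](sum_nat_lt (ltnW (ltn_ord m))).
rewrite /shuffle_b_nat -sum1dep_card big_mkcond; apply: eq_bigr => j _.
have lt_s (a b : 'I_k) : (a < b)%N -> (s (lshift l a) < s (lshift l b))%N.
  exact/implyP/(forallP (inc a)).
case: (ltngtP j m) => [/lt_s -> //|/lt_s mj|/val_inj ->]; last by rewrite ltnn.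
by rewrite ltnNge (ltnW mj).
Qed.

Lemma shuffle_c_rshift k l (s : 'S_(k + l)) (m : 'I_l) : shuffle s ->
  shuffle_c_nat s (s (rshift k m)) = m.
Proof.
move=> /andP[_ /forallP inc]; rewrite -[RHS](sum_nat_lt (ltnW (ltn_ord m))).
rewrite /shuffle_c_nat -sum1dep_card big_mkcond; apply: eq_bigr => j _.
have lt_s (a b : 'I_l) : (a < b)%N -> (s (rshift k a) < s (rshift k b))%N.
  exact/implyP/(forallP (inc a)).
case: (ltngtP j m) => [/lt_s -> //|/lt_s mj|/val_inj ->]; last by rewrite ltnn.
by rewrite ltnNge (ltnW mj).
Qed.

Section Entries.
Variables (G0 N1 G1 : topologicalType) (cm : crossed_module G0 N1 G1).
Variables (k l : nat) (s : 'S_(k + l)).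
Hypothesis shuffle_s : shuffle s.
Variable p : NG cm k l.
Let G := cmG cm.

Lemma base_tilde_shuffle : base (tilde (shuffle_hom s) p) = base p.
Proof.
rewrite base_tilde -[RHS]vertex0; congr (vertex p).
apply: val_inj; rewrite /= ffunE /= shuffle_c_natE /back_steps big1 // => j _.
by rewrite andbF.
Qed.

(** Along the i-th step exactly one of b and c moves, by one: the factor of the other
    coordinate is an empty product, hence a unit. *)
Lemma gs_tilde_shuffle (i : 'I_(k + l)) :
  gs (tilde (shuffle_hom s) p) i =
  match fintype.split ((s^-1)%g i) with
  | inr m => gs p m
  | inl m => gconj G (phi cm (xs p m))
      (gsprod p ord0 (hc (shuffle_hom s) (widen_ord (leqnSn _) i)))
  end.
Proof.
rewrite -[LHS]/(tilde_gs (shuffle_hom s) p i) /tilde_gs.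
set i0 := widen_ord _ i; set i1 := lift ord0 i.
set c := hc _; pose b := mono_of (@shuffle_b_nd k l s).
rewrite -[LHS]/(gmul G (gconj G (phi cm (xprod p (b i0) (b i1)))
  (gsprod p ord0 (c i0))) (gsprod p (c i0) (c i1))).
have bS : (b i1 = b i0 + ((s^-1)%g i < k) :> nat)%N.
  by rewrite !ffunE /= !shuffle_b_natE front_stepsS.
have cS : (c i1 = c i0 + (k <= (s^-1)%g i) :> nat)%N.
  by rewrite !ffunE /= !shuffle_c_natE back_stepsS.
have bE : b i0 = shuffle_b_nat s i :> nat by rewrite !ffunE.
have cE : c i0 = shuffle_c_nat s i :> nat by rewrite !ffunE.
have [t0 s0] := gsprodP p (leq_ord0 (c i0)).
clearbody b c; case: split_ordP bS cS => m mE.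
  rewrite mE /= leqNgt ltn_ord addn0 => bS cS.
  have -> : c i1 = c i0 by exact: val_inj.
  have bm : b i0 = widen_ord (leqnSn k) m.
    by apply: val_inj; rewrite /= bE -{1}(permKV s i) mE shuffle_b_lshift.
  have -> : b i1 = lift ord0 m by apply: val_inj; rewrite /= bS bm addn1.
  rewrite bm xprodS // xprod_nn gmul_unitl ?gtgt_xs // gsprod_nn.
  by rewrite gmul_unitr // gsrc_conj ?gsrc_phi ?gtgt_phi ?cmN_bundle ?gtgt_xs
    ?t0 ?vertex0.
rewrite mE /= leq_addr addn0 => bS cS.
have -> : b i1 = b i0 by exact: val_inj.
rewrite xprod_nn phi_unit -vertex0 -t0 gconj_unit.
have cm0 : c i0 = widen_ord (leqnSn l) m.
  by apply: val_inj; rewrite /= cE -{1}(permKV s i) mE shuffle_c_rshift.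
have -> : c i1 = lift ord0 m by apply: val_inj; rewrite /= cS cm0 addn1.
rewrite s0 cm0 gsprodS // gsprod_nn !gmul_unitl ?gtgt_gs //.
Qed.

Lemma enum_ord_ltn n i : (i <= n)%N ->
  map val [seq j : 'I_n <- enum 'I_n | (j < i)%N] = iota 0 i.
Proof.
move=> le_in; rewrite -(filter_map val (fun j => j < i)%N) val_enum_ord.
exact: filter_iota_ltn.
Qed.

(** The back steps made before time i are the first c(i) ones, in their order, so
    the exponent in the i-th entry is g_1 ... g_{c(i)}. *)
Lemma back_entries i : (i <= k + l)%N ->
  pmap (fun j => if fintype.split ((s^-1)%g j) is inr r
                 then Some (gs p r) else None)
       [seq j : 'I_(k + l) <- enum 'I_(k + l) | (j < i)%N] =
  slice (gs p) 0 (shuffle_c_nat s i).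
Proof.
elim: i => [|i IHi] ikl.
  rewrite shuffle_c_natE /back_steps big1 => [|j _]; last by rewrite andbF.
  by rewrite slice_nn (@eq_filter _ _ pred0) // filter_pred0.
pose i' := Ordinal ikl.
(* the list of times grows by i', which contributes iff its step is a back step *)
have -> : [seq j : 'I_(k + l) <- enum 'I_(k + l) | (j < i.+1)%N] =
          rcons [seq j : 'I_(k + l) <- enum 'I_(k + l) | (j < i)%N] i'.
  apply: (inj_map val_inj); rewrite map_rcons !enum_ord_ltn ?(ltnW ikl) //.
  by rewrite -addn1 iotaD cats1.
rewrite -cats1 pmap_cat IHi ?(ltnW ikl) //=.
have cS : shuffle_c_nat s i.+1 = (shuffle_c_nat s i + (k <= (s^-1)%g i'))%N.
  by rewrite !shuffle_c_natE; exact: (back_stepsS k s i').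
rewrite cS; case: split_ordP => m mE; rewrite mE /=.
  by rewrite leqNgt ltn_ord addn0 cats0.
have -> : shuffle_c_nat s i = m.
  by rewrite -[i]/(val i') -(permKV s i') mE shuffle_c_rshift.
by rewrite leq_addr addn1 slice_rcons // cats1.
Qed.

Lemma gs_tilde_shuffle_entry (i : 'I_(k + l)) :
  gs (tilde (shuffle_hom s) p) i = shuffle_entry s p i.
Proof.
rewrite gs_tilde_shuffle /shuffle_entry; case: fintype.split => // m.
rewrite back_entries ?(ltnW (ltn_ord i)) //.
have [t0 _] := gsprodP p (leq_ord0 (hc (shuffle_hom s) (widen_ord (leqnSn _) i))).
set c := hc _ _ in t0 *.
have -> : shuffle_c_nat s i = c by rewrite /c /= ffunE.
have -> : gprod (cmG cm) (base p) (slice (gs p) 0 c) = gsprod p ord0 c.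
  by rewrite /gsprod vertex0.
rewrite phi_cm_act ?gtgt_xs ?t0 ?vertex0 //.
Qed.
End Entries.

Lemma gs_tilde_insert (G0 N1 G1 : topologicalType) (cm : crossed_module G0 N1 G1)
    p (i : 'I_p.+1) (x : NG cm 1 p) (j : 'I_(1 + p)) :
  gs (tilde (shuffle_hom (insert_perm i)) x) j = insert_entry i x j.
Proof.
rewrite gs_tilde_shuffle ?insert_perm_shuffle // /insert_entry.
case: unliftP => [m ->|->].
  rewrite -(insert_permS i m) permK; case: split_ordP => m' e.
    by move/eqP: e; rewrite eq_rlshift.
  by rewrite (rshift_inj e).
have -> : ((insert_perm i)^-1)%g i = ord0.
  by apply: (canLR (permK _)); rewrite insert_perm0.
case: split_ordP => m' e; last first.
  by have := congr1 val e.
rewrite (ord1 m'); congr (gconj _ _ (gsprod x _ _)); apply: val_inj.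
rewrite /= ffunE /= shuffle_c_natE.
rewrite -[RHS](front_back_steps 1 (insert_perm i) (ltnW (ltn_ord i))).
rewrite /front_steps big1 // => a _; case: a => -[|a] a_lt //=.
have -> : Ordinal a_lt = ord0 by exact: val_inj.
by rewrite insert_perm0 ltnn.
Qed.

(** * The transgression in cohomology *)

(** The back steps fill in increasing order the times left free by the single
    front step. *)
Lemma shuffle1_insert p (s : 'S_(1 + p)) : shuffle s -> insert_perm (s ord0) = s.
Proof.
move=> sh; apply/permP => j; case: (split_ordP j) => m ->.
  by rewrite (ord1 m) (_ : lshift p ord0 = ord0) ?insert_perm0 //; exact: val_inj.
rewrite insert_permS; apply: val_inj => /=.
have front v : front_steps 1 s v = (s ord0 < v)%N.
  rewrite /front_steps big_ord_recl big1 ?addn0 // => i _; rewrite /= /bump /=; lia.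
have := front_back_steps 1 s (ltnW (ltn_ord (s (rshift 1 m)))).
rewrite front -shuffle_c_natE shuffle_c_rshift // /bump.
have : s (rshift 1 m) <> s ord0 :> nat by move/val_inj/perm_inj.
by case: (ltnP (s ord0) (s (rshift 1 m))); case: (leqP (s ord0) m) => /=; lia.
Qed.

Section FirstTransgression.
Variables (G0 N1 G1 : topologicalType) (cm : crossed_module G0 N1 G1).
Variable A : d2complex cm.

Lemma transgression1E q p (a : gsec A q 0 (1 + p)) :
  transgression A q 1 p a =
  \sum_(i < p.+1) pullT A q (shuffle_hom (insert_perm i)) a *~ (-1) ^+ i.
Proof.
rewrite /transgression (reindex (@insert_perm p)) /=; last first.
  exists (fun s : 'S_(1 + p) => s ord0) => [i _|s]; first exact: insert_perm0.
  by rewrite inE => /shuffle1_insert.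
apply: eq_big => [i|i _]; first exact: insert_perm_shuffle.
by rewrite odd_lift_perm odd_perm1 addbF signr_odd.
Qed.

(** The k = 1 component of the total transgression. *)
Definition transgression1 n (c : row_cochains A 0 n.+1) : row_cochains A 1 n :=
  fun i => transgression A (bi_q i) 1 (bi_p i)
             (c (Bideg (congr1 S (bi_eq i) : (1 + bi_p i + bi_q i = n.+1)%N))).

Lemma transgression1_is_zmod_morphism n : zmod_morphism (@transgression1 n).
Proof.
move=> x y; apply: functional_extensionality_dep => i.
exact: (raddfB (transgression A (bi_q i) 1 (bi_p i))).
Qed.
HB.instance Definition _ n :=
  GRing.isZmodMorphism.Build _ _ (@transgression1 n)
    (@transgression1_is_zmod_morphism n).

Lemma transgression1_d n (c : row_cochains A 0 n) p q (e : (p + q = n)%N) :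
  transgression1 (row_d c) (Bideg e) =
  tot_d (total_transgression c) (Trideg (congr1 S e : (1 + p + q = n.+1)%N)).
Proof. by rewrite -total_transgression_d. Qed.

(** For k = 1 the signs (-1)^(k+p) of d and (-1)^k of partial in the total complex
    are opposite to those of the complex of N_1 x| Gamma, and the remaining term
    partial' T_0 vanishes. *)
Lemma transgression1_d_anti n (c : row_cochains A 0 n.+1) :
  transgression1 (row_d c) = - row_d (transgression1 c).
Proof.
apply: functional_extensionality_dep => -[p q e].
rewrite transgression1_d /tot_d /= vdif_row0 addr0.
rewrite -[RHS]/(- (row_d (transgression1 c) (Bideg e))) /row_d /= opprD.
congr (_ + _).
  rewrite add1n mulrz_signS; congr (- (_ *~ _)).
  case: q e => [//|q] e /=; congr ddif; rewrite /total_transgression /transgression1 /=.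
  congr transgression; congr (c (Bideg _)); exact: eq_irrelevance.
rewrite expr1 mulrN1z; congr (- _).
case: p e => [//|p] e /=; congr hdif; rewrite /total_transgression /transgression1 /=.
congr transgression; congr (c (Bideg _)); exact: eq_irrelevance.
Qed.

(** In bidegree (0, 0) the chain map property leaves only the term partial' T_0;
    this makes T_1 send coboundaries to 0 in degree 0, where nothing else is a
    coboundary. *)
Lemma transgression1_d0 (c : row_cochains A 0 0) : transgression1 (row_d c) = 0.
Proof.
apply: functional_extensionality_dep => -[p q e].
rewrite transgression1_d /tot_d /= vdif_row0 addr0.
have /andP[/eqP p0 /eqP q0] : (p == 0)%N && (q == 0)%N by rewrite -addn_eq0 e.
subst p q.
by rewrite !mul0rz addr0.
Qed.

Lemma transgression1_cocycle n (z : cocycles (row_complex A 0) n.+1) :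
  transgression1 (cval z) \in @cocycle (row_complex A 1) n.
Proof.
have /eqP dz : row_d (cval z) == 0 by exact: cvalP z.
change (row_d (transgression1 (cval z)) == 0); apply/eqP.
by rewrite -[LHS]opprK -transgression1_d_anti dz raddf0 oppr0.
Qed.

Definition cocycle_transgression n (z : cocycles (row_complex A 0) n.+1) :
  cocycles (row_complex A 1) n := Cocycle (transgression1_cocycle z).

Lemma transgression1_coboundary n (x : row_complex A 0 n.+1) :
  coboundary x -> @coboundary (row_complex A 1) n (transgression1 x).
Proof.
case: n x => [|n] x [c ->]; first exact: transgression1_d0.
exists (- transgression1 c); rewrite raddfN; exact: transgression1_d_anti.
Qed.

Definition cohomology_transgression n (x : cohomology (row_complex A 0) n.+1) :
  cohomology (row_complex A 1) n := cls (cocycle_transgression (repr x)).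

Lemma cls_eqP (C : cochain_complex) n (x y : cocycles C n) :
  cls x = cls y <-> coboundary (cval x - cval y).
Proof.
rewrite /cls; split=> [/eqP|cob].
  by rewrite -Quotient.idealrBE => /asboolP.
by apply/eqP; rewrite -Quotient.idealrBE; exact/asboolP.
Qed.

Lemma cohomology_transgression_cls n (z : cocycles (row_complex A 0) n.+1) :
  cohomology_transgression (cls z) = cls (cocycle_transgression z).
Proof.
apply/cls_eqP; rewrite /= -raddfB; apply: transgression1_coboundary.
by apply/cls_eqP; rewrite /cls reprK.
Qed.

Lemma cohomology_transgression_is_zmod_morphism n :
  zmod_morphism (@cohomology_transgression n).
Proof.
move=> x y; rewrite -[x]reprK -[y]reprK.
have clsB (C : cochain_complex) m (z w : cocycles C m) :
  cls z - cls w = cls (z - w) by rewrite /cls raddfB.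
rewrite -!/(cls _) clsB !cohomology_transgression_cls clsB.
congr cls; apply: val_inj; exact: (raddfB (@transgression1 n)).
Qed.
HB.instance Definition _ n :=
  GRing.isZmodMorphism.Build _ _ (@cohomology_transgression n)
    (@cohomology_transgression_is_zmod_morphism n).
End FirstTransgression.

Theorem theoremD (G0 N1 G1 : topologicalType) (cm : crossed_module G0 N1 G1)
    (A : d2complex cm) :
  (* 1. *)
  ((exists T : forall n, {additive row_complex A 0 n -> tot_complex A n},
      chain_map T /\
      (forall n (c : row_complex A 0 n) k l q (e : (k + l + q = n)%N),
         T n c (Trideg e) = transgression A q k l (c (Bideg e))) /\
      (forall n (c : row_complex A 0 n) l q (e : (0 + l + q = n)%N),
         T n c (Trideg e) = c (Bideg e))) /\
   (forall k l (s : 'S_(k + l)), shuffle s -> forall p : NG cm k l,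
      base (tilde (shuffle_hom s) p) = base p /\
      forall i : 'I_(k + l),
        gs (tilde (shuffle_hom s) p) i = shuffle_entry s p i)) /\
  (* 2. *)
  ((forall q p (a : gsec A q 0 (1 + p)),
      transgression A q 1 p a =
      \sum_(i < p.+1)
        pullT A q (shuffle_hom (insert_perm i)) a *~ (-1) ^+ i) /\
   (forall p (i : 'I_p.+1) (x : NG cm 1 p) (j : 'I_(1 + p)),
      gs (tilde (shuffle_hom (insert_perm i)) x) j = insert_entry i x j) /\
   (exists tau : forall n,
        {additive cohomology (row_complex A 0) n.+1 -> cohomology (row_complex A 1) n},
      forall n (z : cocycles (row_complex A 0) n.+1),
        exists w : cocycles (row_complex A 1) n,
          (forall p q (e : (p + q = n)%N),
             cval w (Bideg e) =
             transgression A q 1 p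
               (cval z (Bideg (congr1 S e : (1 + p + q = n.+1)%N)))) /\
          tau n (cls z) = cls w)).
Proof.
split; [split|split; [|split]].
- exists (fun n => @total_transgression _ _ _ cm A n : {additive _ -> _}).
  split; first exact: total_transgression_d.
  by split=> // n c l q e; exact: transgression0.
- move=> k l s sh p; split; first exact: base_tilde_shuffle.
  exact: gs_tilde_shuffle_entry.
- exact: transgression1E.
- exact: gs_tilde_insert.
exists (fun n => @cohomology_transgression _ _ _ cm A n : {additive _ -> _}).
move=> n z; exists (cocycle_transgression z).
by split=> //; exact: cohomology_transgression_cls.
Qed.
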